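(* Let $\Gamma_\tau<\mathrm{SA}(\mathbb A^{d+1})$ be an affine deformation of a subgroup $\Gamma<\mathrm{SL}(\mathbb V^{d+1})$ dividing a proper open convex cone $\mathcal C\subset\mathbb V^{d+1}$. The covolume is strictly convex on $\tau$-convex domains, i.e. if $K_0$ and $K_1$ are two distinct $\tau$-convex domains, then for all $0<t<1$, $$\mathrm{covol}\bigl((1-t)K_0+tK_1\bigr)<(1-t)\,\mathrm{covol}(K_0)+t\,\mathrm{covol}(K_1).$$
   Context: Setting: $d\ge2$; $\mathbb V^{d+1}$ is an oriented $(d+1)$-dimensional real vector space with a linear volume form; $\mathbb A^{d+1}$ is the real affine space with translation space $\mathbb V^{d+1}$, with the induced volume measure $\mathrm{vol}$. $\mathrm{SL}(\mathbb V^{d+1})$ and $\mathrm{SA}(\mathbb A^{d+1})$ are the groups of volume preserving linear, resp. affine, automorphisms. A convex cone is proper if it is non-empty and its closure contains no entire line. A convex domain is a non-empty open convex set. A $\mathcal C$-convex domain is a convex domain $K\subset\mathbb A^{d+1}$ whose recession cone $\{v\in\mathbb V^{d+1}:P+\mathbb R_+v\subseteq K\ \forall P\in K\}$ equals $\overline{\mathcal C}$. Convex combinations are $(1-t)K_0+tK_1=\{P+t\overrightarrow{PP'}:P\in K_0,P'\in K_1\}$. Groups: $\Gamma$ divides $\mathcal C$ if it preserves $\mathcal C$ and acts freely, properly discontinuously and cocompactly on $\mathbb P(\mathcal C)$. An affine deformation is a subgroup $\Gamma_\tau<\mathrm{SA}(\mathbb A^{d+1})$ such that taking linear parts is an isomorphism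 $\Gamma_\tau\to\Gamma$. A $\tau$-convex domain is a $\Gamma_\tau$-invariant $\mathcal C$-convex domain. There is a $\tau$-convex domain $D_\tau$ containing all the others, on which $\Gamma_\tau$ acts freely and properly discontinuously. The covolume $\mathrm{covol}(K)$ of a $\tau$-convex domain $K$ is the volume (for the volume induced by $\mathrm{vol}$) of the complement of $K/\Gamma_\tau$ in the manifold $D_\tau/\Gamma_\tau$. *)

(* Defs.v *)
From HB Require Import structures.
From mathcomp Require Import all_boot all_order all_algebra generic_quotient.
From mathcomp Require Import all_classical all_reals all_analysis.

Set Implicit Arguments.
Unset Strict Implicit.
Unset Printing Implicit Defensive.

Import Order.TTheory GRing.Theory Num.Theory.
Import numFieldNormedType.Exports.

Local Open Scope classical_set_scope.
Local Open Scope ring_scope.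
Local Open Scope quotient_scope.

(* The oriented vector space with its volume form is R^n = 'rV[R]_n with the
   determinant in the canonical basis, and the affine space is identified with
   it by the choice of an origin. A matrix A acts on row vectors by
   [x |-> x *m A]. *)

Section measurable_rV.
Context {R : realType} (n : nat).

Let coors (i : 'I_n) (x : 'rV[R]_n) : measurableTypeR R := x ord0 i.

Let rV_set0 : g_sigma_preimage coors set0.
Proof. exact: sigma_algebra0. Qed.

Let rV_setC A : g_sigma_preimage coors A -> g_sigma_preimage coors (~` A).
Proof. exact: sigma_algebraC. Qed.

Let rV_bigcup (F : _^nat) : (forall i, g_sigma_preimage coors (F i)) ->
  g_sigma_preimage coors (\bigcup_i (F i)).
Proof. exact: sigma_algebra_bigcup. Qed.

(* The product of n copies of the Borel sigma-algebra of R, that is, the Borel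
   sigma-algebra of R^n; same construction as the library's on n.-tuple. *)
HB.instance Definition _ := @isMeasurable.Build
  (measure_tuple_display default_measure_display)
  'rV[R]_n (g_sigma_preimage coors) rV_set0 rV_setC rV_bigcup.

Lemma measurable_coord (i : 'I_n) :
  measurable_fun [set: 'rV[R]_n] (fun x => x ord0 i : measurableTypeR R).
Proof.
move=> _ Y mY; rewrite setTI; apply: sub_sigma_algebra => /=.
rewrite -bigcup_seq/=; exists i => /=; first by rewrite mem_index_enum.
by exists Y => //; rewrite setTI.
Qed.

Lemma measurable_fun_rV d (T : measurableType d) (f : T -> 'rV[R]_n) :
  (forall i, measurable_fun setT (fun t => f t ord0 i : measurableTypeR R)) ->
  measurable_fun setT f.
Proof.
move=> mf _ A mA; rewrite setTI.
have : preimage_set_system setT f (g_sigma_preimage coors) (f @^-1` A).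
  by exists A => //; rewrite setTI.
rewrite -g_sigma_preimageE; apply: smallest_sub.
  exact: sigma_algebra_measurable.
move=> _ [B + <-]; rewrite -bigcup_seq/= => -[i _ [Y mY <-]].
by rewrite !setTI; have := mf i measurableT Y mY; rewrite setTI.
Qed.

End measurable_rV.

Section lebesgue_rV.
Context {R : realType}.

Definition cons_rV n (p : measurableTypeR R * 'rV[R]_n) : 'rV[R]_n.+1 :=
  \row_i if unlift ord0 i is Some j then p.2 ord0 j else p.1.

Definition uncons_rV n (x : 'rV[R]_n.+1) : measurableTypeR R * 'rV[R]_n :=
  (x ord0 ord0, \row_j x ord0 (lift ord0 j)).

Lemma cons_rVK n : cancel (@cons_rV n) (@uncons_rV n).
Proof.
move=> [a x]; rewrite /uncons_rV /cons_rV mxE unlift_none /=; congr (_, _).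
by apply/rowP => j; rewrite !mxE liftK.
Qed.

Lemma measurable_cons_rV n : measurable_fun setT (@cons_rV n).
Proof.
apply: measurable_fun_rV => i; under eq_fun do rewrite mxE.
case: (unliftP ord0 i) => [j|] _; last exact: measurable_fst.
exact: (measurableT_comp (measurable_coord j)).
Qed.

Lemma measurable_uncons_rV n : measurable_fun setT (@uncons_rV n).
Proof.
apply/measurable_fun_pairP; split; first exact: measurable_coord.
apply: measurable_fun_rV => i; rewrite /comp/=.
under eq_fun do rewrite mxE.
exact: measurable_coord.
Qed.

Section step.
Context (n : nat) (mu : {sigma_finite_measure set 'rV[R]_n -> \bar R}).

Definition lebesgue_rV_step : set 'rV[R]_n.+1 -> \bar R :=
  pushforward (@lebesgue_measure R \x mu)%E (@cons_rV n).

Let step0 : lebesgue_rV_step set0 = 0%E.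
Proof. by rewrite /lebesgue_rV_step /pushforward preimage_set0 measure0. Qed.

Let step_ge0 A : (0 <= lebesgue_rV_step A)%E.
Proof. exact: (measure_ge0 (@lebesgue_measure R \x mu)%E). Qed.

Let step_sigma_additive : semi_sigma_additive lebesgue_rV_step.
Proof.
move=> F mF tF mUF; rewrite /lebesgue_rV_step /pushforward preimage_bigcup.
have mc (A : set 'rV[R]_n.+1) : measurable A ->
    measurable (@cons_rV n @^-1` A).
  by move=> mA; rewrite -[X in measurable X]setTI; exact: measurable_cons_rV.
apply: measure_semi_sigma_additive.
- by move=> k; exact: mc.
- apply/trivIsetP => /= i j _ _ ij; rewrite -preimage_setI.
  by move/trivIsetP : tF => /(_ _ _ _ _ ij) ->//; rewrite preimage_set0.
- by rewrite -preimage_bigcup; exact: mc.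
Qed.

HB.instance Definition _ := isMeasure.Build _ _ _
  lebesgue_rV_step step0 step_ge0 step_sigma_additive.

Let step_sigma_finite : sigma_finite setT lebesgue_rV_step.
Proof.
have /sigma_finiteP[F [TF ndF Foo]] := sigma_finiteT (@lebesgue_measure R).
have /sigma_finiteP[G [TG ndG Goo]] := sigma_finiteT mu.
exists (fun k => @uncons_rV n @^-1` (F k `*` G k)).
  rewrite -preimage_bigcup -[LHS](preimage_setT (@uncons_rV n)).
  congr (_ @^-1` _); rewrite -setXTT TF TG; apply/seteqP; split => -[x y] /=.
    move=> [[i _ Fix] [j _ Gjy]]; exists (maxn i j) => //; split => /=.
      by move: x Fix; exact/subsetPset/ndF/leq_maxl.
    by move: y Gjy; exact/subsetPset/ndG/leq_maxr.
  by move=> [i _ [/= ? ?]]; split; exists i.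
move=> k; have [mFk Fkoo] := Foo k; have [mGk Gkoo] := Goo k; split.
  rewrite -[X in measurable X]setTI.
  by apply: measurable_uncons_rV => //; exact: measurableX.
rewrite /lebesgue_rV_step /pushforward -comp_preimage.
rewrite (_ : _ \o _ = id) ?preimage_id; last first.
  by apply/funext => p /=; exact: cons_rVK.
by rewrite product_measure1E// lte_mul_pinfty// ge0_fin_numE.
Qed.

HB.instance Definition _ := Measure_isSigmaFinite.Build _ _ _
  lebesgue_rV_step step_sigma_finite.

End step.

Fixpoint lebesgue_rV n : {sigma_finite_measure set 'rV[R]_n -> \bar R} :=
  if n is n'.+1 then lebesgue_rV_step (lebesgue_rV n') else dirac (0 : 'rV[R]_0).

Lemma lebesgue_rV_box n (a b : 'rV[R]_n) : (forall i, a ord0 i <= b ord0 i) ->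
  lebesgue_rV n [set x | forall i, a ord0 i <= x ord0 i <= b ord0 i] =
  (\prod_(i < n) (b ord0 i - a ord0 i))%:E.
Proof.
elim: n a b => [|n IHn] a b ab.
  rewrite big_ord0 /= diracE mem_set// => -[]//.
have tab i : (uncons_rV a).2 ord0 i <= (uncons_rV b).2 ord0 i by rewrite !mxE.
rewrite big_ord_recl /= /lebesgue_rV_step /pushforward.
set B := (X in @cons_rV n @^-1` X).
pose B' := [set x : 'rV[R]_n | forall i,
  (uncons_rV a).2 ord0 i <= x ord0 i <= (uncons_rV b).2 ord0 i].
have mB' : measurable B'.
  rewrite (_ : B' = \bigcap_(i in [set: 'I_n])
    ((fun x : 'rV[R]_n => x ord0 i) @^-1`
      `[(uncons_rV a).2 ord0 i, (uncons_rV b).2 ord0 i]%classic)).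
    apply: fin_bigcap_measurable => // i _.
    rewrite -[X in measurable X]setTI.
    by apply: (@measurable_coord R n i) => //; exact: measurable_itv.
  apply/seteqP; split => x /=.
    by move=> Bx i _ /=; rewrite in_itv/=; exact: Bx.
  by move=> Bx i; have := Bx i I; rewrite /= in_itv.
have -> : @cons_rV n @^-1` B = `[a ord0 ord0, b ord0 ord0]%classic `*` B'.
  apply/seteqP; split => -[x y] /=.
    move=> Bxy; split; first by have := Bxy ord0; rewrite mxE unlift_none in_itv.
    by move=> i; have := Bxy (lift ord0 i); rewrite !mxE liftK.
  move=> [+ By] i; rewrite in_itv/= mxE => ax.
  by case: (unliftP ord0 i) => [j|] ->//; have := By j; rewrite !mxE.
rewrite [LHS]product_measure1E//.
rewrite IHn//= lebesgue_measure_itv/= lte_fin.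
under eq_bigr do rewrite !mxE.
have := ab ord0; rewrite le_eqVlt => /orP[/eqP ->|->].
  by rewrite ltxx mul0e subrr mul0r.
by rewrite -EFinB -EFinM.
Qed.

End lebesgue_rV.

Section actions.
Context {G : Type} (one : G).

Definition acts_freely {T : Type} (act : G -> T -> T) (Gam : set G)
    (X : set T) :=
  forall g x, Gam g -> X x -> act g x = x -> g = one.

Definition acts_properly_discontinuously {T : topologicalType}
    (act : G -> T -> T) (Gam : set G) (X : set T) :=
  forall Q : set T, compact Q -> Q `<=` X ->
    finite_set [set g | Gam g /\ (act g @` Q) `&` Q !=set0].

Definition acts_cocompactly {T : topologicalType} (act : G -> T -> T)
    (Gam : set G) (X : set T) :=
  exists Q : set T,
    [/\ compact Q, Q `<=` X & \bigcup_(g in Gam) (act g @` Q) = X].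

Definition invariant_under {T : Type} (act : G -> T -> T) (Gam : set G)
    (X : set T) :=
  forall g, Gam g -> act g @` X = X.

Definition orbit_of {T : Type} (act : G -> T -> T) (Gam : set G) (x : T) :
  set T := [set act g x | g in Gam].

End actions.

Section linear.
Context {R : realType} {n : nat}.
Local Notation V := 'rV[R]_n.

Definition lin_act (A : 'M[R]_n) (x : V) : V := x *m A.

Definition is_subgroup_SL (Gam : set 'M[R]_n) :=
  [/\ forall A, Gam A -> \det A = 1, Gam 1%:M,
      forall A B, Gam A -> Gam B -> Gam (A *m B)
    & forall A, Gam A -> Gam (invmx A)].

(* x and y span the same line *)
Definition same_span : rel V := fun x y => (x == y)%MS.

Lemma same_span_refl : reflexive same_span.
Proof. by move=> x; rewrite /same_span submx_refl. Qed.

Lemma same_span_sym : symmetric same_span.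
Proof. by move=> x y; rewrite /same_span andbC. Qed.

Lemma same_span_trans : transitive same_span.
Proof.
move=> y x z /andP[xy yx] /andP[yz zy].
by rewrite /same_span (submx_trans xy yz) (submx_trans zy yx).
Qed.

Canonical same_span_equiv :=
  EquivRel same_span same_span_refl same_span_sym same_span_trans.

(* With the quotient topology. The projective space P(V) is the open subspace
   of this quotient obtained by removing the class {0}: every set considered
   below is contained in the image of a cone that does not contain 0. *)
Definition proj_space := quotient_topology {eq_quot same_span}.

Definition proj (x : V) : proj_space := \pi_({eq_quot same_span}) x.

Definition proj_act (A : 'M[R]_n) (p : proj_space) : proj_space :=
  proj (lin_act A (repr (p : {eq_quot same_span}))).

Lemma projP x y : reflect (proj x = proj y) (same_span x y).
Proof. exact: (@eqmodP _ same_span_equiv x y). Qed.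

Lemma proj_actE A x : proj_act A (proj x) = proj (lin_act A x).
Proof.
apply/projP; rewrite /same_span /lin_act.
have /andP[xy yx] : same_span (repr (proj x : {eq_quot same_span})) x.
  by apply/projP; rewrite /proj reprK.
by rewrite !submxMr.
Qed.

Definition convex_cone (C : set V) :=
  convex_set (C : set (convex_lmodType V)) /\
  forall (s : R) x, 0 < s -> C x -> C (s *: x).

Definition proper_cone (C : set V) :=
  C !=set0 /\
  ~ exists x v : V, v != 0 /\ forall s : R, closure C (x + s *: v).

Definition divides (Gam : set 'M[R]_n) (C : set V) :=
  [/\ invariant_under lin_act Gam C,
      acts_freely 1%:M proj_act Gam (proj @` C),
      acts_properly_discontinuously proj_act Gam (proj @` C)
    & acts_cocompactly proj_act Gam (proj @` C)].

(* (A, b) stands for the affine map P |-> P *m A + b *)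
Definition affine_map : Type := 'M[R]_n * V.

Definition aff_act (g : affine_map) (P : V) : V := P *m g.1 + g.2.

Definition aff_id : affine_map := (1%:M, 0).

Definition aff_comp (g h : affine_map) : affine_map :=
  (g.1 *m h.1, g.2 *m h.1 + h.2).

Definition aff_inv (g : affine_map) : affine_map :=
  (invmx g.1, - (g.2 *m invmx g.1)).

Lemma aff_actI : injective aff_act.
Proof.
move=> [A a] [B b] AB.
have {}AB P : P *m A + a = P *m B + b by exact: (congr1 (@^~ P) AB).
have ab : a = b by have := AB 0; rewrite !mul0mx !add0r.
congr (_, _) => //; apply/row_matrixP => i; rewrite !rowE.
by have := AB (delta_mx 0 i); rewrite ab => /addIr.
Qed.

Lemma aff_act_id P : aff_act aff_id P = P.
Proof. by rewrite /aff_act mulmx1 addr0. Qed.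

(* aff_comp g h applies g first: products are those of the row vector action *)
Lemma aff_act_comp g h P : aff_act (aff_comp g h) P = aff_act h (aff_act g P).
Proof. by rewrite /aff_act /= mulmxDl mulmxA addrA. Qed.

Lemma aff_act_inv g P : \det g.1 = 1 -> aff_act (aff_inv g) (aff_act g P) = P.
Proof.
move=> g1; rewrite /aff_act /= mulmxDl mulmxK ?addrK//.
by rewrite unitmxE g1 unitr1.
Qed.

Definition is_subgroup_SA (Gam : set affine_map) :=
  [/\ forall g, Gam g -> \det g.1 = 1, Gam aff_id,
      forall g h, Gam g -> Gam h -> Gam (aff_comp g h)
    & forall g, Gam g -> Gam (aff_inv g)].

(* The linear part g |-> g.1 is always a group morphism, by definition of
   aff_comp: it is an isomorphism Gamt -> Gam if and only if it is bijective. *)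
Definition affine_deformation (Gam : set 'M[R]_n) (Gamt : set affine_map) :=
  is_subgroup_SA Gamt /\ set_bij Gamt Gam fst.

Definition convex_domain (K : set V) :=
  [/\ K !=set0, open K & convex_set (K : set (convex_lmodType V))].

Definition recession_cone (K : set V) : set V :=
  [set v | forall P, K P -> forall s : R, 0 <= s -> K (P + s *: v)].

Definition C_convex_domain (C K : set V) :=
  convex_domain K /\ recession_cone K = closure C.

Definition tau_convex_domain (C : set V) (Gamt : set affine_map) (K : set V) :=
  C_convex_domain C K /\ invariant_under aff_act Gamt K.

Definition max_tau_convex_domain (C : set V) (Gamt : set affine_map)
    (D : set V) :=
  tau_convex_domain C Gamt D /\
  forall K, tau_convex_domain C Gamt K -> K `<=` D.

(* Image in the orbit space of the affine space under Gamt. *)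
Definition quot (Gamt : set affine_map) (X : set V) : set (set V) :=
  orbit_of aff_act Gamt @` X.

(* The volume on D/Gamt induced by the volume of the affine space: the one for
   which the covering D -> D/Gamt preserves the volume of the Borel sets that it
   maps injectively. Since the group is countable, every Borel part S of D/Gamt
   is the injective image of a Borel set, and all such sets have the same
   volume, the largest one among the Borel sets mapped injectively into S. *)
Definition quot_volume (Gamt : set affine_map) (S : set (set V)) : \bar R :=
  ereal_sup [set lebesgue_rV n U | U in
    [set U : set V | [/\ measurable U, set_inj U (orbit_of aff_act Gamt)
                       & quot Gamt U `<=` S]]].

Definition covol (Gamt : set affine_map) (D K : set V) : \bar R :=
  quot_volume Gamt (quot Gamt D `\` quot Gamt K).

Definition convex_comb (t : R) (K0 K1 : set V) : set V :=
  [set P + t *: (P' - P) | P in K0 & P' in K1].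

End linear.

(* Main.v *)
Require Import Defs.
From mathcomp Require Import all_boot all_order all_algebra finmap.
From mathcomp Require Import all_classical all_reals all_analysis.
From mathcomp Require Import measurable_realfun ring lra.

(* Fix a direction e in C. Weight each point x of D by
   l(x, e)^n / sum_g l(x, e g)^n, where n = d + 1 and l(x, q) is the length of
   the part of the ray from x in the direction - q that lies in D. The weights
   of the points of an orbit add up to 1, so that the covolume of K is the
   integral of the weight over D \ K. The weight is nondecreasing along e and,
   on each line parallel to e, the complement of K is a ray ]-oo, a]; the
   integral over it is therefore a convex function of a, and by Fubini's
   theorem the integral over the complement of L_e is at most the convex
   combination of those over the complements of K0 and K1, where L_e is obtained
   by combining K0 and K1 line by line. The set L_e is contained in
   (1 - t) K0 + t K1; if it is smaller, it misses a ball, on which the weight is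
   positive, and the inequality is strict because the integrals are finite. If
   L_e is equal to (1 - t) K0 + t K1, then K0 is the translate of K1 by a
   multiple of e. This cannot happen for two independent directions e unless
   K0 = K1. *)

Set Implicit Arguments.
Unset Strict Implicit.
Unset Printing Implicit Defensive.

Import Order.TTheory GRing.Theory Num.Theory.
Import numFieldNormedType.Exports.

Local Open Scope classical_set_scope.
Local Open Scope ring_scope.

(** * Measure preserving maps *)

(** The set L_e need not be invariant under the group, so that it has no covolume of its own, and a
    fundamental domain has no reason to be a union of rays parallel to e: this is why the covolume
    becomes a weighted integral over all of D \ K. The exponent n of the weight makes the sum over g
    converge: l(x, e g)^n is, up to a constant, the volume of a neighbourhood of x - (l(x, e g) / 4)
    e g obtained from a ball around e by the linear part of g; proper discontinuity on P(C) makes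
    these neighbourhoods disjoint, and they lie in a bounded region. The integrals are finite
    because the points of D where e is the longest among the directions e g meet every orbit, while
    those of them outside K form a bounded set. In the equality case, K0 and K1 lie above the graphs
    of convex functions a and b in the direction e; the hypothesis on L_e compares the increments of
    a and b without any differentiability, and forces a - b to be constant. *)

Section measure_preserving.
Context d (T : measurableType d) (R : realType).
Variable mu : {measure set T -> \bar R}.

Definition measure_preserving (f : T -> T) :=
  measurable_fun setT f /\
  forall A, measurable A -> mu (f @^-1` A) = mu A.

Lemma measure_preserving_id : measure_preserving id.
Proof. by split. Qed.

Lemma measure_preserving_comp f g : measure_preserving f ->
  measure_preserving g -> measure_preserving (f \o g).
Proof.
move=> [mf pf] [mg pg]; split; first exact: measurableT_comp.
move=> A mA; rewrite comp_preimage pg ?pf//.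
by rewrite -[X in measurable X]setTI; exact: mf.
Qed.

Lemma ge0_integral_measure_preserving f D (h : T -> \bar R) :
  measure_preserving f -> measurable D -> measurable_fun D h ->
  (forall x, D x -> (0 <= h x)%E) ->
  (\int[mu]_(x in f @^-1` D) h (f x) = \int[mu]_(x in D) h x)%E.
Proof.
move=> [mf pf] mD mh h0.
rewrite -[LHS](ge0_integral_pushforward mf)//; last by move=> x /[!inE]/h0.
by apply: eq_measure_integral => A mA _; exact: pf.
Qed.

End measure_preserving.

Section product_preserving.
Context d1 d2 (T1 : measurableType d1) (T2 : measurableType d2) (R : realType).
Variables (m1 : {sigma_finite_measure set T1 -> \bar R})
          (m2 : {sigma_finite_measure set T2 -> \bar R}).

Lemma measure_preserving_snd (f : T1 -> T2 -> T2) :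
  measurable_fun setT (fun z => f z.1 z.2) ->
  (forall x, measure_preserving m2 (f x)) ->
  measure_preserving (m1 \x m2)%E (fun z => (z.1, f z.1 z.2)).
Proof.
move=> mf pf; split.
  by apply/measurable_fun_pairP; split => //; exact: measurable_fst.
move=> A mA; apply: eq_integral => x _ /=.
rewrite -((pf x).2 _ (measurable_xsection x mA)); congr (_ _).
Qed.

Lemma measure_preserving_fst (f : T2 -> T1 -> T1) :
  measurable_fun setT (fun z => f z.2 z.1) ->
  (forall y, measure_preserving m1 (f y)) ->
  measure_preserving (m1 \x m2)%E (fun z => (f z.2 z.1, z.2)).
Proof.
move=> mf pf.
(* The product measure integrates the measures of the slices over the first factor; here the slices
   lie in the first factor, so the order of integration is exchanged. *)
have m12 B : measurable B -> (m1 \x m2)%E B = (m1 \x^ m2)%E B.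
  move=> mB; apply: product_measure_unique => // *.
  by rewrite [LHS]product_measure2E.
have mF : measurable_fun setT (fun z : T1 * T2 => (f z.2 z.1, z.2)).
  by apply/measurable_fun_pairP; split => //; exact: measurable_snd.
split=> // A mA; rewrite [RHS]m12// [LHS]m12; last first.
  by rewrite -[X in measurable X]setTI; exact: mF.
apply: eq_integral => y _ /=.
rewrite -((pf y).2 _ (measurable_ysection y mA)); congr (_ _).
Qed.

End product_preserving.

Lemma measure_preserving_shift (R : realType) (a : R) :
  measure_preserving (@lebesgue_measure R)
    (fun x : measurableTypeR R => a + x : measurableTypeR R).
Proof.
have mf : measurable_fun setT
    (fun x : measurableTypeR R => a + x : measurableTypeR R).
  by apply: measurable_funD => //; exact: measurable_id.
split => // A mA; apply/esym.
pose nu := measure_function_pushforward__canonical__measure_function_Measure (@lebesgue_measure R) mf.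
apply: (@lebesgue_measure_unique R nu) => // _ [[u v]] _ <-.
rewrite /= /pushforward.
have -> : (fun x => a + x) @^-1` `]u, v] = `]u - a, v - a]%classic.
  by apply/seteqP; split => x /=; rewrite !in_itv/= ltrBlDl lerBrDl.
rewrite !lebesgue_measure_itv/= !lte_fin ltrD2r; case: ifP => // _.
by rewrite -!EFinB; congr (_%:E); ring.
Qed.

(** * Invariance of the volume of R^n under translations and SL *)

Section lebesgue_rV_invariance.
Context {R : realType}.

Lemma uncons_rVK n : cancel (@uncons_rV R n) (@cons_rV R n).
Proof.
move=> x; apply/rowP => i; rewrite /cons_rV /uncons_rV mxE.
by case: unliftP => [j|] -> //=; rewrite mxE.
Qed.

Lemma cons_rV_row_mx n (a : R) (p : 'rV[R]_n) :
  cons_rV (a, p) = row_mx a%:M p :> 'rV[R]_(1 + n).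
Proof.
apply/rowP => i; rewrite /cons_rV mxE /=.
case: (split_ordP i) => j ->; rewrite ?row_mxEl ?row_mxEr.
  by rewrite (ord1 j) (_ : lshift n ord0 = ord0) ?unlift_none ?mxE//; exact: val_inj.
by rewrite (_ : rshift 1 j = lift ord0 j) ?liftK//; exact: val_inj.
Qed.

Lemma measurable_mulmx n m (A : 'M[R]_(n, m)) :
  measurable_fun setT (fun x : 'rV[R]_n => x *m A).
Proof.
apply: measurable_fun_rV => i; under eq_fun do rewrite mxE.
apply: measurable_sum => j; apply: measurable_funM => //.
exact: measurable_coord.
Qed.

Lemma measurable_funD_rV d (T : measurableType d) n (f g : T -> 'rV[R]_n) :
  measurable_fun setT f -> measurable_fun setT g ->
  measurable_fun setT (fun x => f x + g x).
Proof.
move=> mf mg; apply: measurable_fun_rV => i; under eq_fun do rewrite mxE.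
by apply: measurable_funD;
  apply: (measurableT_comp (measurable_coord i)).
Qed.

Lemma lebesgue_rV_preserving_cons n
    (F : measurableTypeR R * 'rV[R]_n -> measurableTypeR R * 'rV[R]_n)
    (f : 'rV[R]_n.+1 -> 'rV[R]_n.+1) :
  measure_preserving (@lebesgue_measure R \x lebesgue_rV n)%E F ->
  (forall z, f (cons_rV z) = cons_rV (F z)) ->
  measure_preserving (lebesgue_rV n.+1) f.
Proof.
move=> [mF pF] fF.
have fE : f = @cons_rV R n \o F \o @uncons_rV R n.
  by apply/funext => x /=; rewrite -fF uncons_rVK.
split.
  rewrite fE; apply: measurableT_comp; last exact: measurable_uncons_rV.
  by apply: measurableT_comp => //; exact: measurable_cons_rV.
move=> A mA /=; rewrite /lebesgue_rV_step /pushforward.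
rewrite -[RHS]pF; last first.
  by rewrite -[X in measurable X]setTI; exact: measurable_cons_rV.
by congr (_ _); apply/seteqP; split => z /=; rewrite fF.
Qed.

Lemma lebesgue_rV_translation n (b : 'rV[R]_n) :
  measure_preserving (lebesgue_rV n) (fun x => b + x).
Proof.
elim: n b => [|n IHn] b.
  rewrite (_ : (fun x => _) = id); first exact: measure_preserving_id.
  by apply/funext => x; apply/rowP => -[].
have p1 : measure_preserving (@lebesgue_measure R \x lebesgue_rV n)%E
    (fun z => (z.1, (uncons_rV b).2 + z.2)).
  apply: (@measure_preserving_snd _ _ _ _ _ _ _
    (fun _ p => (uncons_rV b).2 + p)) => //.
  apply: measurable_funD_rV => //; exact: measurable_snd.
have p2 : measure_preserving (@lebesgue_measure R \x lebesgue_rV n)%E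
    (fun z => (b ord0 ord0 + z.1 : measurableTypeR R, z.2)).
  refine (@measure_preserving_fst _ _ _ _ R lebesgue_measure (lebesgue_rV n)
    (fun _ a => b ord0 ord0 + a : measurableTypeR R) _ _).
    by apply: measurable_funD => //; exact: measurable_fst.
  by move=> _; exact: measure_preserving_shift.
apply: (lebesgue_rV_preserving_cons (measure_preserving_comp p1 p2)).
move=> [a p]; apply/rowP => i; rewrite !mxE /=.
by case: unliftP => [j|] -> //=; rewrite !mxE.
Qed.

Let P n (A : 'M[R]_n) :=
  measure_preserving (lebesgue_rV n) (fun x => x *m A).

Let P_mul n (A B : 'M[R]_n) : P A -> P B -> P (A *m B).
Proof.
move=> PA PB; rewrite /P (_ : (fun x => _) = (fun x => x *m B) \o (fun x => x *m A)).
  exact: measure_preserving_comp.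
by apply/funext => x /=; rewrite mulmxA.
Qed.

Let P_ublock n (b : 'rV[R]_n) : P (block_mx 1%:M b 0 1%:M : 'M[R]_(1 + n)).
Proof.
apply: (@lebesgue_rV_preserving_cons _ (fun z => (z.1, z.1 *: b + z.2))).
  refine (@measure_preserving_snd _ _ _ _ R lebesgue_measure (lebesgue_rV n)
    (fun a p => a *: b + p) _ _).
    apply: measurable_funD_rV; last exact: measurable_snd.
    apply: measurable_fun_rV => i; under eq_fun do rewrite mxE.
    by apply: measurable_funM => //; exact: measurable_fst.
  by move=> a; exact: lebesgue_rV_translation.
move=> [a p]; rewrite !cons_rV_row_mx mul_row_block !mulmx1 mulmx0 addr0.
by rewrite mul_scalar_mx.
Qed.

Let P_lblock n (c : 'cV[R]_n) : P (block_mx 1%:M 0 c 1%:M : 'M[R]_(1 + n)).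
Proof.
apply: (@lebesgue_rV_preserving_cons _
    (fun z => ((z.2 *m c) ord0 ord0 + z.1 : measurableTypeR R, z.2))).
  refine (@measure_preserving_fst _ _ _ _ R lebesgue_measure (lebesgue_rV n)
    (fun p a => (p *m c) ord0 ord0 + a : measurableTypeR R) _ _).
    apply: measurable_funD; last exact: measurable_fst.
    apply: (measurableT_comp (measurable_coord ord0)).
    by apply: (measurableT_comp (measurable_mulmx c)); exact: measurable_snd.
  by move=> p; exact: measure_preserving_shift.
move=> [a p]; rewrite !cons_rV_row_mx mul_row_block !mulmx1 mulmx0 add0r.
rewrite /=; suff -> : a%:M + p *m c = ((p *m c) ord0 ord0 + a)%:M by [].
by apply/rowP => i; rewrite !ord1 addrC !mxE eqxx.
Qed.

Let P_dblock n (D : 'M[R]_n) : P D -> P (block_mx 1%:M 0 0 D : 'M[R]_(1 + n)).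
Proof.
move=> PD; apply: (@lebesgue_rV_preserving_cons _ (fun z => (z.1, z.2 *m D))).
  refine (@measure_preserving_snd _ _ _ _ R lebesgue_measure (lebesgue_rV n)
    (fun a p => p *m D) _ _) => //.
  by apply: (measurableT_comp (measurable_mulmx D)); exact: measurable_snd.
move=> [a p]; rewrite !cons_rV_row_mx mul_row_block !mulmx0 mulmx1.
by rewrite addr0 add0r.
Qed.

(* SL is generated by transvections: these are shears, so that their invariance
   follows from Fubini's theorem and translation invariance. *)
Lemma lebesgue_rV_SL n (A : 'M[R]_n) : \det A = 1 ->
  measure_preserving (lebesgue_rV n) (fun x => x *m A).
Proof.
elim: n A => [|n IHn] A.
  move=> _; rewrite (_ : (fun x => _) = id); first exact: measure_preserving_id.
  by apply/funext => x; apply/rowP => -[].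
rewrite -/(P A); move: A; rewrite -[n.+1]/(1 + n)%N => A.
(* When the top left entry is 1, Gaussian elimination writes B as a product of two shears and the
   Schur complement, which has determinant 1 and smaller size. *)
have step1 (B : 'M[R]_(1 + n)) : \det B = 1 -> ulsubmx B = 1%:M -> P B.
  move=> B1 Bul; rewrite -(submxK B) Bul.
  set b := ursubmx B; set c := dlsubmx B; set D := drsubmx B.
  have E : block_mx 1%:M b c D = block_mx 1%:M 0 c 1%:M *m
      block_mx 1%:M 0 0 (D - c *m b) *m block_mx 1%:M b 0 1%:M.
    rewrite !mulmx_block !(mulmx0, mul0mx, mulmx1, mul1mx, addr0, add0r).
    by rewrite addrC subrK.
  rewrite E; apply: P_mul (P_ublock b); apply: P_mul (P_lblock c) _.
  apply: P_dblock; apply: IHn.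
  by rewrite -B1 -[in RHS](submxK B) Bul E !det_mulmx
    !(det_lblock, det_ublock) !det1 !mul1r mulr1.
(* A nonzero entry of the first row off the diagonal serves to bring the top left entry to 1 by one
   column operation. *)
have step2 (B : 'M[R]_(1 + n)) : \det B = 1 -> ursubmx B != 0 -> P B.
  move=> B1 /rV0Pn[j bj].
  pose w : 'cV[R]_n :=
    \col_i if i == j then (1 - ulsubmx B ord0 ord0) / ursubmx B ord0 j else 0.
  have SK : block_mx 1%:M 0 w 1%:M *m block_mx 1%:M 0 (- w) 1%:M
      = 1%:M :> 'M[R]_(1 + n).
    rewrite !mulmx_block !(mulmx0, mul0mx, mulmx1, mul1mx, addr0, add0r) subrr.
    by rewrite scalar_mx_block.
  rewrite -[B]mulmx1 -SK mulmxA; apply: P_mul (P_lblock _); apply: step1.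
    by rewrite det_mulmx B1 det_lblock !det1 !mulr1.
  rewrite -[in LHS](submxK B) mulmx_block block_mxKul !mulmx1.
  apply/matrixP => i k; rewrite !ord1 mxE [X in _ + X]mxE (bigD1 j)//= big1.
    by rewrite [w _ _]mxE eqxx addr0 mulrC divfK// addrC subrK [RHS]mxE eqxx.
  by move=> l /negPf lj; rewrite [w _ _]mxE lj mulr0.
move=> A1; have [b0|] := eqVneq (ursubmx A) 0; last exact: step2.
have aD : ulsubmx A ord0 ord0 * \det (drsubmx A) = 1.
  by rewrite -A1 -[in RHS](submxK A) b0 det_lblock det_mx11.
case: n => [|m] in IHn A step1 step2 A1 b0 aD *.
  apply: step1 => //; apply/matrixP => i j; rewrite !ord1 [RHS]mxE -[RHS]aD.
  by rewrite det_mx00 mulr1.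
have a0 : ulsubmx A ord0 ord0 != 0.
  by apply: contra_eq_neq aD => ->; rewrite mul0r eq_sym oner_neq0.
(* The first row is zero off the diagonal: adding its first column to the others makes these entries
   equal to the nonzero corner, and the previous case applies. *)
pose u : 'rV[R]_m.+1 := const_mx 1.
have SK : block_mx 1%:M u 0 1%:M *m block_mx 1%:M (- u) 0 1%:M
    = 1%:M :> 'M[R]_(1 + m.+1).
  rewrite !mulmx_block !(mulmx0, mul0mx, mulmx1, mul1mx, addr0, add0r) addNr.
  by rewrite scalar_mx_block.
rewrite -[A]mulmx1 -SK mulmxA; apply: P_mul (P_ublock _); apply: step2.
  by rewrite det_mulmx A1 det_ublock !det1 !mulr1.
apply/rV0Pn; exists ord0.
rewrite -[in X in X != 0](submxK A) mulmx_block block_mxKur b0 mul0mx addr0.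
by rewrite mxE big_ord1 [u _ _]mxE mulr1.
Qed.

End lebesgue_rV_invariance.

(** * Topology and volume of R^n *)

Section rV_topology.
Context {R : realType} {n : nat}.
Implicit Types (x y : 'rV[R]_n) (r : R).

Lemma coord_le_norm x i : `|x ord0 i| <= `|x|.
Proof.
by rewrite /Num.norm/= mx_normrE; apply/bigmax_geP; right; exists (ord0, i). Qed.

Lemma rV_norm_ltP x r : 0 < r ->
  (`|x| < r) <-> (forall i, `|x ord0 i| < r).
Proof.
move=> r0; split=> [xr i|xr]; first exact: le_lt_trans (coord_le_norm x i) xr.
rewrite /Num.norm/= mx_normrE; apply/bigmax_ltP; split => // -[i j] _ /=.
by rewrite (ord1 i).
Qed.

Lemma rV_norm_leP x r : 0 <= r ->
  (`|x| <= r) <-> (forall i, `|x ord0 i| <= r).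
Proof.
move=> r0; split=> [xr i|xr]; first exact: le_trans (coord_le_norm x i) xr.
rewrite /Num.norm/= mx_normrE; apply/bigmax_leP; split => // -[i j] _ /=.
by rewrite (ord1 i).
Qed.

Lemma openP_norm (U : set 'rV[R]_n) : open U <->
  forall x, U x -> exists2 r : R, 0 < r & forall y, `|x - y| < r -> U y.
Proof.
rewrite openE; split => [oU x /oU|oU x /oU[r r0 rU]].
  move=> /nbhs_ballP[r /= r0 rU]; exists r => // y xy; apply: rU.
  by rewrite mx_norm_ball.
by apply/nbhs_ballP; exists r => //= y; rewrite mx_norm_ball; exact: rU.
Qed.

Lemma closureP_norm (U : set 'rV[R]_n) x : closure U x <->
  forall r, 0 < r -> exists2 y, U y & `|x - y| < r.
Proof.
split => [cU r r0|cU B /nbhs_ballP[r /= r0 rB]].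
  have [] := cU (ball x r); first exact: nbhsx_ballx.
  by move=> y [Uy]; rewrite mx_norm_ball => xy; exists y.
by have [y Uy xy] := cU _ r0; exists y; split => //; apply: rB; rewrite mx_norm_ball.
Qed.

Definition box x r :=
  [set y : 'rV[R]_n | forall i, x ord0 i - r <= y ord0 i <= x ord0 i + r].

Lemma boxP x r y : 0 <= r -> box x r y <-> `|x - y| <= r.
Proof.
move=> r0; rewrite rV_norm_leP//; split => xy i; have := xy i; rewrite !mxE.
  by rewrite ler_distlC.
by rewrite ler_distlC.
Qed.

Lemma measurable_box x r : measurable (box x r).
Proof.
rewrite (_ : box x r = \bigcap_(i in [set: 'I_n])
  ((fun x : 'rV[R]_n => x ord0 i) @^-1` `[x ord0 i - r, x ord0 i + r]%classic)).
  apply: fin_bigcap_measurable => // i _.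
  rewrite -[X in measurable X]setTI.
  by apply: (@measurable_coord R n i) => //; exact: measurable_itv.
apply/seteqP; split => y /=.
  by move=> By i _ /=; rewrite in_itv/=; exact: By.
by move=> By i; have := By i I; rewrite /= in_itv.
Qed.

Lemma lebesgue_rV_cube x r : 0 <= r ->
  lebesgue_rV n (box x r) = ((2 * r) ^+ n)%:E.
Proof.
move=> r0; pose c : 'rV[R]_n := const_mx r.
rewrite (_ : box x r =
    [set y : 'rV[R]_n | forall i, (x - c) ord0 i <= y ord0 i <= (x + c) ord0 i]).
  rewrite lebesgue_rV_box.
    congr (_%:E); rewrite -[in RHS](card_ord n) -prodr_const.
    by apply: eq_bigr => i _; rewrite !mxE; ring.
  by move=> i; rewrite !mxE; lra.
by apply/seteqP; split => y + i => /(_ i); rewrite !mxE.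
Qed.

(** The sigma-algebra is the one generated by the coordinates: an open set belongs to it as the
    countable union of the boxes with rational centre and radius 1/(k + 1) that it contains. *)
Lemma open_measurable_rV (U : set 'rV[R]_n) : open U -> measurable U.
Proof.
move=> /openP_norm oU.
pose B (p : 'rV[rat]_n * nat) := box (map_mx ratr p.1) p.2.+1%:R^-1.
pose F m := if choice.unpickle m is Some p then
  (if `[< B p `<=` U >] then B p else set0) else set0.
rewrite (_ : U = \bigcup_m F m).
  apply: bigcupT_measurable => m; rewrite /F; case: choice.unpickle => // p.
  by case: ifP => // _; exact: measurable_box.
apply/seteqP; split=> [x Ux|x [m _]]; last first.
  by rewrite /F; case: choice.unpickle => // p; case: ifP => // /asboolP; exact.
have [r r0 rU] := oU _ Ux.
(* Half of r, because a point of the box and x may each be at distance 1/(k + 1) from the centre. *)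
have [k kr] : exists k, k.+1%:R^-1 < r / 2.
  have /ltr_add_invr[k] : 0 < r / 2 by rewrite divr_gt0.
  by rewrite add0r => ?; exists k.
have k0 : 0 < k.+1%:R^-1 :> R by rewrite invr_gt0 ltr0n.
have /choice[a aP] i : exists q : rat,
    ratr q \in `]x ord0 i - k.+1%:R^-1, x ord0 i + k.+1%:R^-1[.
  by apply: rat_in_itvoo; rewrite ltrD2l -subr_gt0 opprK addr_gt0.
have xB : B (\row_i a i, k) x.
move=> i; have := aP i; rewrite in_itv/= !mxE /= => /andP[h1 h2].
  by apply/andP; split; [rewrite lerBlDr|rewrite -lerBlDr]; exact: ltW.
exists (choice.pickle (\row_i a i, k)) => //; rewrite /F choice.pickleK asboolT// => y /= By.
apply: rU; apply/rV_norm_ltP => // i; rewrite !mxE ltr_norml.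
have := By i; have := xB i; rewrite /=; move: kr.
by move: k.+1%:R^-1 => e ? /andP[? ?] /andP[? ?]; apply/andP; split; lra.
Qed.

Lemma bounded_rV_fin (U : set 'rV[R]_n) M : measurable U ->
  (forall x, U x -> `|x| <= M) -> (lebesgue_rV n U < +oo)%E.
Proof.
move=> mU UM; apply: (@le_lt_trans _ _ (lebesgue_rV n (box 0 `|M|))).
  apply: le_measure; rewrite ?inE//; first exact: measurable_box.
  move=> x Ux; apply/boxP => //; rewrite sub0r normrN.
  exact: le_trans (UM _ Ux) (ler_norm _).
by rewrite lebesgue_rV_cube// ltry.
Qed.

Lemma open_rV_gt0 (U : set 'rV[R]_n) : open U -> U !=set0 ->
  (0 < lebesgue_rV n U)%E.
Proof.
move=> oU [x Ux]; have [r r0 rU] := (openP_norm U).1 oU _ Ux.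
apply: (@lt_le_trans _ _ (lebesgue_rV n (box x (r / 2)))).
  by rewrite lebesgue_rV_cube ?lte_fin ?exprn_gt0//; lra.
apply: le_measure; rewrite ?inE//; first exact: measurable_box.
  exact: open_measurable_rV.
by move=> y /boxP xy; apply: rU; apply: le_lt_trans (xy _) _; lra.
Qed.

Lemma bounded_seq_cluster (u : nat -> 'rV[R]_n) M : (forall k, `|u k| <= M) ->
  exists l, forall r, 0 < r -> forall N, exists2 k, (N <= k)%N & `|u k - l| < r.
Proof.
move=> uM.
have cK : compact [set x : 'rV[R]_n | `|x| <= M].
  apply: bounded_closed_compact.
    exists M; split; first exact: num_real.
    by move=> N MN x /= xM; exact: le_trans xM (ltW MN).
  rewrite (_ : mkset _ = Num.norm @^-1` [set y | y <= M])//.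
  apply: preimage_closed => [x _|]; last exact: closed_le.
  exact: norm_continuous.
have [|l [_ cl]] := cK (u @ \oo) _; first by exists 0%N => // k _ /=; exact: uM.
exists l => r r0 N.
have [||_ [[k Nk <-]]] := cl [set u k | k in [set k | (N <= k)%N]] (ball l r).
- by exists N => // k /= Nk; exists k.
- exact: nbhsx_ballx.
by rewrite mx_norm_ball /ball_ /= distrC => lr; exists k.
Qed.

End rV_topology.

Lemma aff_act_preserving (R : realType) n (g : @affine_map R n) :
  \det g.1 = 1 -> measure_preserving (lebesgue_rV n) (aff_act g).
Proof.
move=> g1; rewrite (_ : aff_act g = (fun x => g.2 + x) \o (fun x => x *m g.1)).
  by apply: measure_preserving_comp;
    [exact: lebesgue_rV_translation|exact: lebesgue_rV_SL].
by apply/funext => x; rewrite /aff_act /= addrC.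
Qed.

Ltac rV_ring := apply/rowP => ?; rewrite !mxE; ring.
Ltac rV_lra := apply/rowP => ?; rewrite !mxE; lra.
Ltac rV_field := apply/rowP => ?; rewrite !mxE; field; rewrite ?pnatr_eq0 //.

(** * Convex sets, cones and past lengths *)

Section convex_sets.
Context {R : realType} {n : nat}.
Local Notation V := 'rV[R]_n.
Implicit Types (x y z p : V) (s r : R) (K : set V).

Definition cvx K := forall x y s, K x -> K y -> 0 <= s -> s <= 1 ->
  K (s *: x + (1 - s) *: y).

Lemma convex_set_cvx K : convex_set (K : set (convex_lmodType V)) -> cvx K.
Proof.
move=> cK x y s Kx Ky s0 s1.
by have := cK x y (Itv01 s0 s1); rewrite !inE => /(_ Kx Ky).
Qed.

(** Replacing z by a nearby point z' of K is compensated by moving p by (1 - s)/s times the error,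
    which the openness of K at p absorbs. *)
Lemma cvx_interior K p z s : open K -> cvx K -> K p -> closure K z ->
  0 < s -> s <= 1 -> K (s *: p + (1 - s) *: z).
Proof.
move=> /openP_norm oK cK Kp /closureP_norm cz s0 s1.
have [r r0 rK] := oK _ Kp.
have [z' Kz' zz'] := cz (s * r) (mulr_gt0 s0 r0).
pose p' := p + ((1 - s) / s) *: (z - z').
rewrite (_ : _ + _ = s *: p' + (1 - s) *: z').
  apply: cK => //; last exact: ltW.
  apply: rK; rewrite /p' opprD addrA subrr sub0r normrN normrZ.
  rewrite ger0_norm ?divr_ge0 ?subr_ge0 ?(ltW s0)//.
  apply: (@le_lt_trans _ _ (s^-1 * `|z - z'|)).
    rewrite ler_wpM2r// ler_piMl ?invr_ge0 ?(ltW s0)//; lra.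
  by rewrite mulrC ltr_pdivrMr// mulrC.
by rewrite /p'; have s0' := lt0r_neq0 s0; rV_field.
Qed.

Lemma cvx_recession K u : open K -> cvx K ->
  (forall P, K P -> forall s, 0 <= s -> closure K (P + s *: u)) ->
  recession_cone K u.
Proof.
move=> oK cK Ku P KP s s0.
rewrite (_ : _ + _ = 2^-1 *: P + (1 - 2^-1) *: (P + (2 * s) *: u)).
  by apply: cvx_interior => //; [apply: Ku => //; lra|lra].
by rV_lra.
Qed.

(** The point of the segment from P to p + w k at the fraction s / |w k| differs from P + s u by at
    most s |w k / |w k| - u| + (s / |w k|) |p - P|, which is small for suitable large k. *)
Lemma recession_cluster K p (w : nat -> V) u : open K -> cvx K -> K p ->
  (forall k, closure K (p + w k)) -> (forall k, k%:R < `|w k|) ->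
  (forall r, 0 < r -> forall N, exists2 k, (N <= k)%N &
    `| `|w k|^-1 *: w k - u| < r) ->
  recession_cone K u.
Proof.
move=> oK cK Kp cw w_big wu; apply: cvx_recession => // P KP s s0.
apply/closureP_norm => r r0.
pose N := (Num.bound (s + 1 + 2 * s * `|p - P| / r)).
have r1 : 0 < r / (2 * (s + 1)) by rewrite divr_gt0//; lra.
have [k Nk wk] := wu _ r1 N.
have a0 : 0 <= 2 * s * `|p - P| / r.
  by rewrite divr_ge0 ?(ltW r0)// !mulr_ge0//.
have wN : s + 1 + 2 * s * `|p - P| / r < `|w k|.
  apply: lt_trans (w_big k); apply: (@lt_le_trans _ _ N%:R).
    by rewrite /N; apply: archi_boundP; lra.
  by rewrite ler_nat.
have w0 : 0 < `|w k| by lra.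
pose l := s / `|w k|.
have l0 : 0 <= l by rewrite divr_ge0// ltW.
have l1 : l < 1 by rewrite ltr_pdivrMr//; lra.
exists ((1 - l) *: P + (1 - (1 - l)) *: (p + w k)).
  by apply: cvx_interior; rewrite ?subr_gt0 ?gerBl.
rewrite (_ : _ - _ = - (s *: (`|w k|^-1 *: w k - u)) - l *: (p - P)); last first.
  by have := lt0r_neq0 w0; rewrite /l; move: (`|w k|) => q q0; rV_field.
apply: le_lt_trans (ler_normB _ _) _; rewrite normrN !normrZ !ger0_norm//.
have h1 : s * `| `|w k|^-1 *: w k - u| <= r / 2.
  apply: (@le_trans _ _ (s * (r / (2 * (s + 1))))).
    by apply: ler_wpM2l => //; exact: ltW.
  rewrite -subr_ge0 (_ : _ - _ = r / (2 * (s + 1))); last by field; lra.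
  exact: ltW.
rewrite -/l; suff : l * `|p - P| < r / 2 by lra.
rewrite /l mulrAC ltr_pdivrMr//.
have : 2 * s * `|p - P| / r < `|w k| by lra.
by rewrite ltr_pdivrMr//; lra.
Qed.

End convex_sets.

Section cones.
Context {R : realType} {n : nat}.
Local Notation V := 'rV[R]_n.
Variable C : set V.
Hypotheses (C_open : open C) (C_cone : convex_cone C) (C_proper : proper_cone C).
Implicit Types (x y z p u v c : V) (s r : R).

Lemma coneZ s x : 0 < s -> C x -> C (s *: x).
Proof. by case: C_cone => _; exact. Qed.

Lemma cone_cvx : cvx C.
Proof. by case: C_cone => + _; exact: convex_set_cvx. Qed.

Lemma coneD x y : C x -> C y -> C (x + y).
Proof.
move=> Cx Cy; rewrite (_ : x + y = 2 *: (2^-1 *: x + (1 - 2^-1) *: y)).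
  by apply: coneZ => //; apply: cone_cvx => //; lra.
by rV_lra.
Qed.

Lemma cone_closureD x c : C x -> closure C c -> C (x + c).
Proof.
move=> Cx /closureP_norm cc; have [r r0 rC] := (openP_norm C).1 C_open _ Cx.
have [c' Cc' c'c] := cc _ r0.
rewrite (_ : x + c = (x + (c - c')) + c'); last by rV_ring.
by apply: coneD => //; apply: rC; rewrite opprD addrA subrr sub0r normrN.
Qed.

Lemma closure_coneZ s c : 0 < s -> closure C c -> closure C (s *: c).
Proof.
move=> s0 /closureP_norm cc; apply/closureP_norm => r r0.
have [c' Cc' c'c] := cc _ (divr_gt0 r0 s0).
exists (s *: c'); first exact: coneZ.
by rewrite -scalerBr normrZ gtr0_norm// mulrC -ltr_pdivlMr.
Qed.

Lemma closure_cone0 : closure C 0.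
Proof.
case: C_proper => -[x Cx] _; apply/closureP_norm => r r0.
exists ((r / (`|x| + 1)) *: x).
  by apply: coneZ => //; rewrite divr_gt0// ltr_wpDl.
have x1 : 0 < `|x| + 1 by rewrite ltr_wpDl.
rewrite sub0r normrN normrZ ger0_norm; last by rewrite ltW// divr_gt0.
by rewrite mulrAC ltr_pdivrMr// ltr_pM2l//; lra.
Qed.

Lemma closure_cone_pointed u : closure C u -> closure C (- u) -> u = 0.
Proof.
move=> Cu CNu; apply/eqP/negPn/negP => u0; case: C_proper => _; apply.
exists 0, u; split=> // s; rewrite add0r.
have [s0|s0|->] := ltgtP s 0.
- by rewrite -(opprK s) scaleNr -scalerN; apply: closure_coneZ => //; lra.
- exact: closure_coneZ.
- by rewrite scale0r; exact: closure_cone0.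
Qed.

Lemma cone_ball x : C x -> exists2 r : R, 0 < r & forall y, `|y| < r -> C (x + y).
Proof.
move=> Cx; have [r r0 rC] := (openP_norm C).1 C_open _ Cx; exists r => // y yr.
by apply: rC; rewrite opprD addrA subrr sub0r normrN.
Qed.

Lemma cone0F : (0 < n)%N -> ~ C 0.
Proof.
move=> n0 /cone_ball[r r0 rC]; have Cx : forall y, C y.
  move=> y; have y1 : 0 < (`|y| + 1) / r by rewrite divr_gt0// ltr_wpDl.
  rewrite -[y]scale1r -(divff (lt0r_neq0 y1)) -scalerA; apply: coneZ => //.
  rewrite -[_ *: y]add0r; apply: rC; rewrite normrZ ger0_norm ?invr_ge0 1?ltW//.
  rewrite invf_div mulrAC ltr_pdivrMr ?ltr_wpDl// ltr_pM2l//.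
  by rewrite ltrDl.
have /rowP/(_ (Ordinal n0)) : const_mx 1 = 0 :> V.
  by apply: closure_cone_pointed; apply: subset_closure; exact: Cx.
by rewrite !mxE => /eqP; rewrite oner_eq0.
Qed.

End cones.

(** * Asymptotics of C-convex domains and lengths of past rays *)

Section convex_domains.
Context {R : realType} {n : nat}.
Local Notation V := 'rV[R]_n.
Variables (C D : set V).
Hypotheses (C_open : open C) (C_cone : convex_cone C) (C_proper : proper_cone C).
Hypothesis D_dom : C_convex_domain C D.
Implicit Types (x y z p v c q e : V) (s r u : R).

Lemma dom_open : open D. Proof. by case: D_dom => -[]. Qed.

Lemma dom_cvx : cvx D.
Proof. by case: D_dom => -[_ _ /convex_set_cvx]. Qed.

Lemma dom_recession (u : V) : recession_cone D u <-> closure C u.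
Proof. by case: D_dom => _ ->. Qed.

Lemma domD x c : D x -> closure C c -> D (x + c).
Proof.
move=> Dx /dom_recession/(_ _ Dx 1 ler01); by rewrite scale1r.
Qed.

Lemma domD_cone x c : D x -> C c -> D (x + c).
Proof. by move=> Dx Cc; apply: domD => //; exact: subset_closure. Qed.

(** Otherwise the directions of a sequence of counterexamples going to infinity cluster at some l,
    which is a recession direction; then |w k| l is a point of the closed cone too close to w k. *)
Lemma dom_asymptotic p r : D p -> 0 < r ->
  exists M : R, forall w, closure D (p + w) -> M < `|w| ->
    exists2 c, closure C c & `|w - c| <= r * `|w|.
Proof.
move=> Dp r0; apply: contrapT => /forallNP noM.
have /choice[w wP] (k : nat) : exists w : V, [/\ closure D (p + w), k%:R < `|w|
    & forall c, closure C c -> r * `|w| < `|w - c|].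
  have /existsNP[w /not_implyP[cw /not_implyP[kw nc]]] := noM k%:R.
  exists w; split => // c Cc; rewrite ltNge; apply/negP => wc.
  by apply: nc; exists c.
have w0 k : 0 < `|w k| by have [_ + _] := wP k; exact: le_lt_trans.
have [k|l lP] := @bounded_seq_cluster R n (fun k => `|w k|^-1 *: w k) 1.
  by rewrite normrZ normfV normr_id mulVf// gt_eqF.
have Cl : closure C l.
  apply/dom_recession; apply: (recession_cluster dom_open dom_cvx Dp) lP => k.
    by have [] := wP k.
  by have [] := wP k.
have [k _ kl] := lP r r0 0%N; have [_ _ /(_ (`|w k| *: l))] := wP k.
have -> : w k - `|w k| *: l = `|w k| *: (`|w k|^-1 *: w k - l).
  by rewrite scalerBr scalerA divff ?gt_eqF// scale1r.
rewrite normrZ normr_id mulrC ltr_pM2l// => /(_ (closure_coneZ C_cone (w0 k) Cl)).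
by move/(lt_trans kl); rewrite ltxx.
Qed.

(** If the vectors v were unbounded, a limit direction l of the points x - v would be a recession
    direction, hence in the closed cone, and so would - l as a limit of multiples of v: the cone
    would contain a line. *)
Lemma dom_past_bounded x :
  exists M : R, forall v, closure C v -> D (x - v) -> `|v| <= M.
Proof.
apply: contrapT => /forallNP noM.
have [p Dp] : D !=set0 by case: D_dom => -[].
have /choice[v vP] (k : nat) : exists v : V, [/\ closure C v, D (x - v) &
    k%:R + `|x - p| < `|v|].
  have /existsNP[v /not_implyP[cv /not_implyP[Dv /negP]]] := noM (k%:R + `|x - p|).
  by rewrite -ltNge; exists v.
pose w k := x - v k - p.
have w_big k : k%:R < `|w k|.
  have [_ _] := vP k; have : `|v k| <= `|w k| + `|x - p|.
    rewrite (_ : v k = - w k + (x - p)); last by rewrite /w; rV_ring.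
    by apply: le_trans (ler_normD _ _) _; rewrite normrN.
  by lra.
have w0 k : 0 < `|w k| by exact: le_lt_trans (w_big k).
have [k|l lP] := @bounded_seq_cluster R n (fun k => `|w k|^-1 *: w k) 1.
  by rewrite normrZ normfV normr_id mulVf// gt_eqF.
have Cl : closure C l.
  apply/dom_recession.
  apply: (recession_cluster dom_open dom_cvx Dp _ w_big lP) => k.
  by apply: subset_closure; rewrite addrC subrK; have [] := vP k.
have CNl : closure C (- l).
  apply: closed_closure; apply/closureP_norm => r r0.
  have r2 : 0 < r / 2 by lra.
  have [k Nk kl] := lP _ r2 (Num.bound (2 * `|x - p| / r)).
  exists (`|w k|^-1 *: v k).
    by apply: closure_coneZ; rewrite ?invr_gt0//; have [] := vP k.
  have -> : - l - `|w k|^-1 *: v k =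
      (`|w k|^-1 *: w k - l) - `|w k|^-1 *: (x - p).
    by rewrite /w; rV_ring.
  apply: le_lt_trans (ler_normB _ _) _; rewrite normrZ normfV normr_id.
  suff : `|w k|^-1 * `|x - p| < r / 2 by lra.
  rewrite mulrC ltr_pdivrMr//.
  suff : 2 * `|x - p| / r < `|w k| by rewrite ltr_pdivrMr//; lra.
  apply: lt_trans (w_big k); apply: lt_le_trans (archi_boundP _) _.
    by rewrite divr_ge0 ?mulr_ge0// ltW.
  by rewrite ler_nat.
have l0 := closure_cone_pointed C_cone C_proper Cl CNl.
have [k _] := lP _ (@ltr01 R) 0%N; rewrite l0 subr0 normrZ normfV normr_id.
by rewrite mulVf ?gt_eqF// ltxx.
Qed.

Definition past_length x q := sup [set s | 0 <= s /\ D (x - s *: q)].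

Let has_sup_past x q : q != 0 -> D x -> C q ->
  has_sup [set s | 0 <= s /\ D (x - s *: q)].
Proof.
move=> q0 Dx Cq; split; first by exists 0; rewrite /= scale0r subr0.
have [M MP] := dom_past_bounded x; exists (M / `|q|) => s /= [s0 Ds].
have qn0 : 0 < `|q| by rewrite normr_gt0.
rewrite ler_pdivlMr// -[s in s * _]ger0_norm// -normrZ; apply: MP => //.
have [->|s1] := eqVneq s 0; first by rewrite scale0r; exact: closure_cone0.
by apply: subset_closure; apply: coneZ; rewrite // lt0r s1.
Qed.

(** The admissible s form the half-open interval [0, [past_length x q][: they are closed downwards
    since D + C is contained in D, and the upper end is excluded since D is open. *)
Lemma past_lengthP x q s : q != 0 -> D x -> C q -> 0 <= s ->
  (s < past_length x q) <-> D (x - s *: q).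
Proof.
move=> q0 Dx Cq s0; have hs := has_sup_past q0 Dx Cq.
split=> [sl|Ds].
  have d0 : 0 < past_length x q - s by rewrite subr_gt0.
  have [s' [s'0 Ds']] := sup_adherent d0 hs.
  rewrite -/(past_length x q) opprB addrC subrK => ss'.
  rewrite (_ : x - s *: q = x - s' *: q + (s' - s) *: q); last by rV_ring.
  by apply: domD_cone => //; apply: coneZ; rewrite ?subr_gt0.
have [r r0 rD] := (openP_norm D).1 dom_open _ Ds.
have qn0 : 0 < `|q| by rewrite normr_gt0.
have e0 : 0 < r / (2 * `|q|) by rewrite divr_gt0 ?mulr_gt0.
apply: (@lt_le_trans _ _ (s + r / (2 * `|q|))); first by rewrite ltrDl.
apply: ub_le_sup; first by case: hs.
split; first by rewrite addr_ge0// ltW.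
apply: rD; rewrite (_ : _ - _ = (r / (2 * `|q|)) *: q); last by rV_ring.
rewrite normrZ gtr0_norm//; have -> : r / (2 * `|q|) * `|q| = r / 2.
  by field; lra.
by lra.
Qed.

Lemma past_length_gt0 x q : q != 0 -> D x -> C q -> 0 < past_length x q.
Proof. by move=> q0 Dx Cq; apply/past_lengthP; rewrite ?scale0r ?subr0. Qed.

Lemma past_length_closure x q : q != 0 -> D x -> C q ->
  closure D (x - past_length x q *: q).
Proof.
move=> q0 Dx Cq; have l0 := past_length_gt0 q0 Dx Cq.
apply/closureP_norm => r r0.
have qn0 : 0 < `|q| by rewrite normr_gt0.
have e0 : 0 < r / (2 * `|q|) by rewrite divr_gt0 ?mulr_gt0.
have re : r / (2 * `|q|) * `|q| = r / 2 by field; lra.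
move: e0 re; generalize (r / (2 * `|q|)) => e e0 re.
pose s := if e <= past_length x q then past_length x q - e else 0.
have [s0 sl se] : [/\ 0 <= s, s < past_length x q & past_length x q - s <= e].
  rewrite /s; case: (leP e (past_length x q)) => ?; split=> //; lra.
exists (x - s *: q); first by apply/past_lengthP.
rewrite (_ : _ - _ = - ((past_length x q - s) *: q)); last by rV_ring.
rewrite normrN normrZ ger0_norm; last by lra.
by apply: le_lt_trans (ler_wpM2r (normr_ge0 q) se) _; lra.
Qed.

Lemma past_length_le x q M : q != 0 -> D x -> C q ->
  (forall s, 0 <= s -> s < past_length x q -> s <= M) -> past_length x q <= M.
Proof.
move=> q0 Dx Cq sM; have l0 := past_length_gt0 q0 Dx Cq.
have M0 : 0 <= M by exact: sM.
rewrite leNgt; apply/negP => Ml.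
have : (M + past_length x q) / 2 <= M by apply: sM; lra.
by move: Ml; lra.
Qed.

Lemma past_length_shift x q u : q != 0 -> D x -> C q -> 0 <= u ->
  past_length (x + u *: q) q = past_length x q + u.
Proof.
move=> q0 Dx Cq u0.
have Dxu : D (x + u *: q).
  have [->|un0] := eqVneq u 0; first by rewrite scale0r addr0.
  by apply: domD_cone => //; apply: coneZ; rewrite // lt0r un0.
have E s : x + u *: q - s *: q = x - (s - u) *: q by rV_ring.
apply/eqP; rewrite eq_le; apply/andP; split.
  apply: past_length_le => // s s0 /past_lengthP; rewrite E => /(_ q0 Dxu Cq s0).
  have [su _|us] := leP s u; first by have := past_length_gt0 q0 Dx Cq; lra.
  by move/past_lengthP; rewrite subr_ge0 ltrBlDr => h; apply: ltW; apply: h => //; exact: ltW.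
rewrite -lerBrDr; apply: past_length_le => // s s0 sl; rewrite lerBrDr ltW//.
by apply/past_lengthP; rewrite ?addr_ge0// E addrK; apply/past_lengthP.
Qed.

(* Contraction towards the end point of the past ray from x in the
   direction e preserves D by convexity. *)
Lemma past_length_homothety x e q u : e != 0 -> q != 0 -> D x -> C e -> C q ->
  0 <= u ->
  past_length (x + u *: e) q * past_length x e <=
  past_length x q * (past_length x e + u).
Proof.
move=> e0 q0 Dx Ce Cq u0.
have Dxu : D (x + u *: e).
  have [->|un0] := eqVneq u 0; first by rewrite scale0r addr0.
  by apply: domD_cone => //; apply: coneZ; rewrite // lt0r un0.
have l0 := past_length_gt0 e0 Dx Ce.
have cl := past_length_closure e0 Dx Ce.
move: (past_length x e) l0 cl => l l0 cl.
have lu0 : 0 < l + u by lra.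
rewrite -ler_pdivlMr//; apply: past_length_le => // s s0.
move=> /past_lengthP => /(_ q0 Dxu Cq s0) Ds.
have m0 : 0 < l / (l + u) by rewrite divr_gt0.
rewrite ler_pdivlMr// -ler_pdivrMr// -mulrA ltW//.
apply/past_lengthP => //; first by rewrite mulr_ge0// ltW.
(* The homothety of ratio l / (l + u) centred at x - l e maps x + u e to x. *)
rewrite (_ : _ - _ = (l / (l + u)) *: (x + u *: e - s *: q) +
  (1 - l / (l + u)) *: (x - l *: e)); last first.
  by have := lt0r_neq0 lu0 => ?; rV_field.
apply: (cvx_interior dom_open dom_cvx) => //.
by rewrite ler_pdivrMr//; lra.
Qed.

End convex_domains.

Lemma finite_set_min {R : realType} (T : choiceType) (M : set T)
    (P : T -> R -> Prop) : finite_set M ->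
  (forall A r s, 0 < s -> s <= r -> P A r -> P A s) ->
  (forall A, M A -> exists2 r : R, 0 < r & P A r) ->
  exists2 r : R, 0 < r & forall A, M A -> P A r.
Proof.
move=> /finite_seqP[F ->] Pm.
elim: F => [|A s IH] h; first by exists 1.
have [r r0 rP] : exists2 r : R, 0 < r & forall A, A \in s -> P A r.
  by apply: IH => B Bs; apply: h; rewrite /= inE Bs orbT.
have [q q0 qP] := h A (mem_head _ _).
have m0 : 0 < Num.min r q by rewrite lt_min r0.
exists (Num.min r q) => // B /=; rewrite inE => /orP[/eqP->|Bs].
  by apply: Pm qP => //; rewrite ge_min lexx orbT.
by apply: Pm (rP _ Bs) => //; rewrite ge_min lexx.
Qed.

(** * Groups dividing a cone *)

Section projective_action.
Context {R : realType} {n : nat}.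
Local Notation V := 'rV[R]_n.
Implicit Types (x y v w e o : V) (s r : R).

Lemma dproj_eqP x y : x != 0 -> Defs.proj x = Defs.proj y -> exists2 a : R, a != 0 & x = a *: y.
Proof.
move=> x0 /projP/andP[/sub_rVP[a xay] _]; exists a => //.
by apply: contra_neq x0 => a0; rewrite xay a0 scale0r.
Qed.

Lemma dproj_scale s x : s != 0 -> Defs.proj (s *: x) = Defs.proj x.
Proof.
move=> s0; apply/projP/andP; split; first exact: scalemx_sub.
by rewrite -[X in (X <= _)%MS]scale1r -(mulVf s0) -scalerA scalemx_sub.
Qed.

Lemma dproj_continuous : continuous (@Defs.proj R n).
Proof. exact: pi_continuous. Qed.

Lemma proj_open_map (W : set V) : ~ W 0 -> open W -> open (@Defs.proj R n @` W).
Proof.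
move=> W0 oW; rewrite /open /= /quotient_open.
apply/openP_norm => x [w Ww] /=.
have w0 : w != 0 by apply/eqP => w0; apply: W0; rewrite -w0.
move=> /(dproj_eqP w0)[a a0 wax].
have [r r0 rW] := (openP_norm W).1 oW _ Ww.
have na0 : 0 < `|a| by rewrite normr_gt0.
exists (r / `|a|) => [|y xy]; first by rewrite divr_gt0.
exists (a *: y); last exact: dproj_scale.
by apply: rW; rewrite wax -scalerBr normrZ mulrC -ltr_pdivlMr.
Qed.

End projective_action.

Lemma mulmx_coord_continuous {R : realType} {n : nat} (A : 'M[R]_n) (j : 'I_n) :
  continuous (fun x : 'rV[R]_n => (x *m A) ord0 j).
Proof.
rewrite (_ : (fun x => _) =
    fun x : 'rV[R]_n => \sum_k x ord0 k * A k j); last first.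
  by apply/funext => x; rewrite mxE.
apply: continuous_big => [|k _]; first exact: add_continuous.
move=> x; apply: (@continuousM R 'rV[R]_n (fun y => y ord0 k) (cst (A k j))).
  exact: coord_continuous.
exact: cst_continuous.
Qed.

Section dividing_group.
Context {R : realType} {n : nat}.
Local Notation V := 'rV[R]_n.
Variables (C : set V) (Gam : set 'M[R]_n).
Hypotheses (n_gt0 : (0 < n)%N).
Hypotheses (C_open : open C) (C_cone : convex_cone C) (C_proper : proper_cone C).
Hypotheses (Gam_SL : is_subgroup_SL Gam) (Gam_div : divides Gam C).
Implicit Types (x y v w e o : V) (s r : R) (A : 'M[R]_n).

Lemma gam_unit A : Gam A -> A \in unitmx.
Proof. by case: Gam_SL => + _ _ _ => /[apply] A1; rewrite unitmxE A1 unitr1. Qed.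

Lemma gam_cone A x : Gam A -> C x -> C (x *m A).
Proof. by case: Gam_div => inv _ _ _ GA Cx; rewrite -(inv _ GA); exists x. Qed.

Lemma gam_coneV A x : Gam A -> C (x *m A) -> C x.
Proof.
move=> GA CxA; rewrite -(mulmxK (gam_unit GA) x); apply: gam_cone => //.
by case: Gam_SL => _ _ _; exact.
Qed.

Lemma cone_mem_neq0 x : C x -> x != 0.
Proof.
by move=> Cx; apply/eqP => x0; apply: (cone0F C_open C_cone C_proper n_gt0); rewrite -x0.
Qed.

(** This is freeness on P(C), put in terms of a 2 x 2 minor in order to extend by continuity to the
    neighbours of e. *)
Lemma gam_not_parallel A e : Gam A -> A <> 1%:M -> C e ->
  exists i j, e ord0 i * (e *m A) ord0 j != e ord0 j * (e *m A) ord0 i.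
Proof.
move=> GA A1 Ce; apply: contrapT => nij; apply: A1.
have par i j : e ord0 i * (e *m A) ord0 j = e ord0 j * (e *m A) ord0 i.
  by apply: contrapT => /eqP ij; apply: nij; exists i, j.
have CeA := gam_cone GA Ce.
have /rV0Pn[i ei] := cone_mem_neq0 Ce.
have eAE : e *m A = ((e *m A) ord0 i / e ord0 i) *: e.
  by apply/rowP => j; rewrite [RHS]mxE mulrAC [X in X / _]mulrC -par mulrC mulKf.
case: Gam_div => _ free _ _; apply: (free _ (Defs.proj e)) => //.
rewrite proj_actE /lin_act eAE dproj_scale//.
by apply: contra_neq (cone_mem_neq0 CeA) => a0; rewrite eAE a0 scale0r.
Qed.

(** A small ball around e spans a cone disjoint from its images under the nontrivial elements.
    Proper discontinuity, applied to the compact image of a ball, leaves finitely many A; each of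
    them is excluded by shrinking the ball. *)
Lemma gam_disjoint_cones e : C e -> exists2 r : R, 0 < r &
  (forall y, `|e - y| <= r -> C y) /\
  forall A, Gam A -> A <> 1%:M -> forall o o' s, `|e - o| <= r -> `|e - o'| <= r ->
    s != 0 -> o *m A <> s *: o'.
Proof.
move=> Ce; have [r r0 rC] := (openP_norm C).1 C_open _ Ce.
pose B := [set y | `|e - y| <= r / 2].
have BC y : B y -> C y by move=> yr; apply: rC; apply: le_lt_trans yr _; lra.
have cB : compact B.
  apply: bounded_closed_compact.
    exists (`|e| + r / 2); split; first exact: num_real.
    move=> N MN x /= xM; apply: le_trans (ltW MN).
    rewrite (_ : x = e - (e - x)); last by rV_ring.
    by apply: le_trans (ler_normB _ _) _; rewrite lerD2l.
  rewrite (_ : B = (fun y => `|e - y|) @^-1` [set y | y <= r / 2])//.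
  apply: preimage_closed => [x _|]; last exact: closed_le.
  apply: (@continuous_comp _ _ _ (fun y => e - y) (fun y => `|y|)).
    by apply: continuousB; [exact: cst_continuous|exact: id].
  exact: norm_continuous.
have cQ : compact (@Defs.proj R n @` B).
  apply: continuous_compact => //; apply: continuous_subspaceT.
  exact: dproj_continuous.
have QC : Defs.proj @` B `<=` Defs.proj @` C by move=> _ [y /BC Cy <-]; exists y.
case: (Gam_div) => _ _ pd _; have fM := pd _ cQ QC.
pose P A r := A <> 1%:M -> forall o o' s, `|e - o| <= r -> `|e - o'| <= r ->
    s != 0 -> o *m A <> s *: o'.
have [|A [GA _]|q q0 qP] := @finite_set_min R _ _ P fM.
- move=> A a b b0 ba PA A1 o o' s oa o'a s0; apply: PA => //.
    exact: le_trans ba.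
  exact: le_trans ba.
- have [A1|A1] := pselect (A = 1%:M); first by exists 1.
  have [i [j ij]] := gam_not_parallel GA A1 Ce.
  (* This minor vanishes when o A and o' are proportional, but not at (e, e), hence not near it. *)
  pose f (z : V * V) :=
    z.2 ord0 i * (z.1 *m A) ord0 j - z.2 ord0 j * (z.1 *m A) ord0 i.
  have cf : continuous f.
    have c2 k : continuous (fun z : V * V => z.2 ord0 k).
      move=> z; apply: (@continuous_comp _ _ _ snd (fun y : V => y ord0 k)).
        exact: cvg_snd.
      exact: coord_continuous.
    have c1 k : continuous (fun z : V * V => (z.1 *m A) ord0 k).
      move=> z; apply: (@continuous_comp _ _ _ fst (fun y : V => (y *m A) ord0 k)).
        exact: cvg_fst.
      exact: mulmx_coord_continuous.
    by move=> z; apply: (@continuousB R R^o (V * V)%type); apply: (@continuousM R (V * V)%type);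
      [exact: c2|exact: c1|exact: c2|exact: c1].
  have f0 : 0 < `|f (e, e)| by rewrite normr_gt0 subr_eq0.
  have /cvgr_dist_lt/(_ _ f0)/nbhs_ballP[q q0 qf] := cf (e, e).
  exists (q / 2); first by rewrite divr_gt0.
  move=> _ o o' s oq o'q s0 oA.
  have : ball (e, e) q (o, o').
    by split; rewrite mx_norm_ball /ball_ /=; apply: le_lt_trans; eauto;
      rewrite ltr_pdivrMr// ltr_pMr//; lra.
  move=> /qf /=; rewrite /f /= oA !mxE.
  by rewrite [X in _ - X](_ : _ = 0) ?subr0 ?ltxx//; ring.
exists (Num.min q (r / 2)); first by rewrite lt_min q0; lra.
split=> [y|A GA A1 o o' s].
  by rewrite le_min => /andP[_ ?]; apply: BC.
rewrite !le_min => /andP[oq o_r] /andP[oq2 or2] s0 oA.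
apply: (qP A _ A1 _ _ _ oq oq2 s0 oA); split => //.
exists (Defs.proj o'); split; last by exists o'.
by exists (Defs.proj o); [exists o|rewrite proj_actE /lin_act oA dproj_scale].
Qed.

(* The sets W k of vectors comparable with e exhaust C and are open, so
   that one of them meets every Gam-orbit of lines. *)
Lemma gam_cocompact e : C e -> exists2 m : R, 0 < m & forall v, C v ->
  exists A w s, [/\ Gam A, 0 < s, v = s *: (w *m A), C (m *: w - e) & C (m *: e - w)].
Proof.
move=> Ce.
pose W (k : nat) := [set w : V | C (k.+1%:R *: w - e) /\ C (k.+1%:R *: e - w)].
have k0 k : 0 < k.+1%:R :> R by rewrite ltr0n.
have WC k w : W k w -> C w.
  case=> /(coneD C_cone)/(_ Ce); rewrite subrK => Ckw _.
  rewrite -[w]scale1r -(mulVf (lt0r_neq0 (k0 k))) -scalerA.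
  by apply: coneZ; rewrite ?invr_gt0.
have W_mono k l w : (k <= l)%N -> W k w -> W l w.
  move=> kl Ww; have Cw := WC _ _ Ww; case: Ww => W1 W2.
  have [kl1|kl1] := eqVneq k l; first by rewrite -kl1.
  have d0 : 0 < l.+1%:R - k.+1%:R :> R.
    by rewrite subr_gt0 ltr_nat ltnS ltn_neqAle kl1.
  by split; [rewrite (_ : _ - e = (k.+1%:R *: w - e) + (l.+1%:R - k.+1%:R) *: w)|
    rewrite (_ : _ - w = (k.+1%:R *: e - w) + (l.+1%:R - k.+1%:R) *: e)];
    try (by rV_ring); apply: coneD => //; apply: coneZ.
have W0 k : ~ W k 0 by move=> /WC; exact: cone0F.
have oW k : open (W k).
  apply/openP_norm => w [W1 W2].
  have [r r0 rC] := cone_ball C_open W1; have [q q0 qC] := cone_ball C_open W2.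
  exists (Num.min (r / k.+1%:R) q); first by rewrite lt_min divr_gt0.
  move=> y; rewrite lt_min => /andP[wr wq]; split.
    rewrite (_ : _ - e = (k.+1%:R *: w - e) - k.+1%:R *: (w - y)); last by rV_ring.
    by apply: rC; rewrite normrN normrZ gtr0_norm// mulrC -ltr_pdivlMr.
  by rewrite (_ : _ - y = (k.+1%:R *: e - w) + (w - y)); [exact: qC|rV_ring].
have CW c : C c -> exists k, W k c.
  move=> Cc; have [r r0 rC] := cone_ball C_open Cc.
  have [q q0 qC] := cone_ball C_open Ce.
  have e0 : 0 <= `|e| / r by rewrite divr_ge0// ltW.
  have c0 : 0 <= `|c| / q by rewrite divr_ge0// ltW.
  pose k := Num.bound (`|e| / r + `|c| / q).
  have kb : `|e| / r + `|c| / q < k.+1%:R.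
    apply: lt_le_trans (archi_boundP _) _; first by rewrite addr_ge0.
    by rewrite ler_nat.
  exists k; split.
    rewrite -[e in X in C X](scalerKV (lt0r_neq0 (k0 k))) -scalerBr.
    apply: coneZ => //; apply: rC; rewrite normrN normrZ gtr0_norm ?invr_gt0//.
    by rewrite mulrC ltr_pdivrMr// mulrC -ltr_pdivrMr//; lra.
  rewrite -[c in X in C X](scalerKV (lt0r_neq0 (k0 k))) -scalerBr.
  apply: coneZ => //; apply: qC; rewrite normrN normrZ gtr0_norm ?invr_gt0//.
  by rewrite mulrC ltr_pdivrMr// mulrC -ltr_pdivrMr//; lra.
case: (Gam_div) => _ _ _ [Q [cQ QC Qcov]].
have [k Qk] : exists k, Q `<=` @Defs.proj R n @` W k.
  move: cQ; rewrite compact_cover => /(_ _ setT (fun k => @Defs.proj R n @` W k)).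
  case=> [k _|x Qx|F _ FQ].
  - exact: proj_open_map.
  - have [c Cc <-] := QC _ Qx; have [k Wk] := CW _ Cc.
    by exists k => //; exists c.
  exists (\max_(i <- enum_fset F) i) => x /FQ[i /= iF [w Ww <-]].
  exists w => //; apply: W_mono Ww.
  by apply: (leq_bigmax_seq (F := id)).
exists k.+1%:R => // v Cv.
have : (@Defs.proj R n @` C) (Defs.proj v) by exists v.
rewrite -Qcov => -[A GA [_ /Qk[w Ww <-]]]; rewrite proj_actE /lin_act => wAv.
have Cw := WC _ _ Ww; have CwA := gam_cone GA Cw.
have [a a0 va] := dproj_eqP (cone_mem_neq0 Cv) (esym wAv).
case: Ww => W1 W2; exists A, w, a; split => //.
(* With a negative, 0 = v - a (w A) would be a sum of two vectors of C. *)
rewrite lt0r a0/= leNgt; apply/negP => aN.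
apply: (cone0F C_open C_cone C_proper n_gt0).
rewrite -(subrr v) [X in _ - X]va -scaleNr.
by apply: coneD => //; apply: coneZ => //; rewrite oppr_gt0.
Qed.

End dividing_group.

(** * Sums and intersections over countable sets *)

(** Turns sums over a countable set into series over the naturals satisfying a predicate, to which
    the theorems on integrals of series apply; the predicate covers the finite and infinite cases at
    once. *)
Lemma countable_enum (I : choiceType) (A : set I) : countable A -> A !=set0 ->
  exists (e : nat -> I) (P : pred nat), e @` [set` P] = A /\ set_inj [set` P] e.
Proof.
move=> /countable_injP[f finj] [i0 Ai0].
pose P := [pred k | `[< exists2 i, A i & f i = k >]].
pose e k := xget i0 [set i | A i /\ f i = k].
have eP k : P k -> A (e k) /\ f (e k) = k.
  move=> /asboolP[i Ai fi]; rewrite /e; case: xgetP => [x _ //|].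
  by move=> /(_ i); case.
exists e, P; split; last first.
  move=> k l /set_mem/eP[_ fk] /set_mem/eP[_ fl] ekl.
  by rewrite -fk ekl.
apply/seteqP; split=> [_ [k /eP[? _] <-]//|i Ai].
have Pk : P (f i) by apply/asboolP; exists i.
exists (f i) => //; have [Ae fe] := eP _ Pk.
by apply: finj fe; rewrite inE.
Qed.

Section countable_esum.
Context d (T : measurableType d) (R : realType) (I : choiceType) (A : set I).
Variables (mu : {measure set T -> \bar R}) (D : set T) (a : I -> T -> \bar R).
Hypothesis cA : countable A.
Hypothesis a0 : forall i x, A i -> (0 <= a i x)%E.
Hypothesis ma : forall i, A i -> measurable_fun D (a i).

Lemma measurable_fun_esum : measurable_fun D (fun x => \esum_(i in A) a i x)%E.
Proof.
have [->|/set0P A0] := eqVneq A set0.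
  by under eq_fun do rewrite esum_set0; exact: measurable_cst.
have [e [P [eA einj]]] := countable_enum cA A0.
have AP k : P k -> A (e k) by move=> Pk; rewrite -eA; exists k.
rewrite (_ : (fun x => _) = fun x => (\sum_(k <oo | k \in P) a (e k) x)%E).
  by apply: ge0_emeasurable_sum => [k x _|k] /AP Ak; [exact: a0|exact: ma].
  by apply/funext => x; rewrite -eA esum_pred_image// => k /AP; exact: a0.
Qed.

Lemma integral_esum : measurable D ->
  (\int[mu]_(x in D) (\esum_(i in A) a i x) =
   \esum_(i in A) (\int[mu]_(x in D) a i x))%E.
Proof.
move=> mD; have [->|/set0P A0] := eqVneq A set0.
  rewrite esum_set0 -[RHS](integral0 mu D).
  by apply: eq_integral => x _; rewrite esum_set0.
have [e [P [eA einj]]] := countable_enum cA A0.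
have AP k : P k -> A (e k) by move=> Pk; rewrite -eA; exists k.
rewrite -eA esum_pred_image//; last first.
  by move=> k /AP Ak; apply: integral_ge0 => x _; exact: a0.
rewrite eseries_mkcond.
pose b k x := if P k then a (e k) x else 0%E.
transitivity (\int[mu]_(x in D) (\sum_(k <oo) b k x))%E.
  apply: eq_integral => x _; rewrite esum_pred_image//; last first.
    by move=> k /AP; exact: a0.
  by rewrite eseries_mkcond.
rewrite integral_nneseries//.
- apply: eq_eseriesr => k _; rewrite /b -[k \in P]/(P k).
  by case: (P k) => /=; [reflexivity|apply: (integral0 mu D)].
- by move=> k; rewrite /b; case Pk: (P k); [exact/ma/AP|exact: measurable_cst].
- by move=> k x _; rewrite /b; case: ifPn => // /AP; exact: a0.
Qed.

Lemma countable_esumZl c x : 0 <= c ->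
  (\esum_(i in A) (c%:E * a i x) = c%:E * (\esum_(i in A) a i x))%E.
Proof.
move=> c0; have [->|/set0P A0] := eqVneq A set0.
  by rewrite !esum_set0 mule0.
have [e [P [eA einj]]] := countable_enum cA A0.
have AP k : P k -> A (e k) by move=> Pk; rewrite -eA; exists k.
rewrite -eA !esum_pred_image//.
- by rewrite nneseriesZl// => k /AP; exact: a0.
- by move=> k /AP; exact: a0.
- by move=> k /AP Ak; rewrite mule_ge0//; exact: a0.
Qed.

End countable_esum.

(** * Convexity along a direction *)

Section monotone_primitive.
Context {R : realType}.
Local Notation leb := (@lebesgue_measure R).
Variable g : R -> R.
Hypotheses (mg : measurable_fun setT g) (g0 : forall x, 0 <= g x).
Hypothesis g_mono : forall x y, x <= y -> g x <= g y.

Local Notation I c := (\int[leb]_(x in `]-oo, c]) (g x)%:E)%E.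

Let mgD (D : set R) : measurable_fun D (fun x => (g x)%:E).
Proof. by apply/measurable_EFinP; exact: measurable_funTS. Qed.

Let primitive_split (a b : R) : a <= b ->
  I b = (I a + (\int[leb]_(x in `]a, b]) (g x)%:E))%E.
Proof.
move=> ab; rewrite -ge0_integral_setU//=.
- by congr (integral _ _ _); rewrite -itv_bndbnd_setU.
- exact: mgD.
- by move=> x _; rewrite lee_fin.
- by apply/disj_setPS => x [/=]; rewrite !in_itv/= => xa /andP[/lt_le_trans/(_ xa)]; rewrite ltxx.
Qed.

Let integral_itv_cst (a b c : R) : a <= b ->
  (\int[leb]_(x in `]a, b]) c%:E = (c * (b - a))%:E)%E.
Proof.
move=> ab; rewrite integral_cst//= lebesgue_measure_itv/= lte_fin.
have [ab'|] := ltP a b; first by rewrite -EFinB -EFinM.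
by move=> ba; rewrite (le_anti (introT andP (conj ab ba))) subrr mulr0 mule0.
Qed.

(** Let A and B be the integrals over ]a, c] and ]c, b]. The claim amounts to (1 - t) A <= t B, and
    monotonicity gives A <= g(c) (c - a) = t g(c) (b - a) and B >= g(c) (b - c) = (1 - t) g(c) (b -
    a). *)
Let primitive_convex_le (a b t : R) : 0 < t -> t < 1 -> a <= b ->
  (I ((1 - t) * a + t * b)%R <= (1 - t)%:E * I a + t%:E * I b)%E.
Proof.
move=> t0 t1 ab; set c := _ + _.
have ac : a <= c by rewrite /c; nra.
have cb : c <= b by rewrite /c; nra.
have I0 d : (0 <= I d)%E by apply: integral_ge0 => x _; rewrite lee_fin.
have t1' : 0 < 1 - t by rewrite subr_gt0.
rewrite (primitive_split ac) (primitive_split (le_trans ac cb)).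
have -> : ((\int[leb]_(x in `]a, b]) (g x)%:E) =
    (\int[leb]_(x in `]a, c]) (g x)%:E) + (\int[leb]_(x in `]c, b]) (g x)%:E))%E.
  rewrite -ge0_integral_setU//=.
  - by congr (integral _ _ _); rewrite -itv_bndbnd_setU.
  - exact: mgD.
  - by move=> x _; rewrite lee_fin.
  - apply/disj_setPS => x [/=]; rewrite !in_itv/= => /andP[_ xa].
    by move=> /andP[/lt_le_trans/(_ xa)]; rewrite ltxx.
have A0 : (0 <= \int[leb]_(x in `]a, c]) (g x)%:E)%E.
  by apply: integral_ge0 => x _; rewrite lee_fin.
have A1 : (\int[leb]_(x in `]a, c]) (g x)%:E <= (g c * (c - a))%:E)%E.
  rewrite -integral_itv_cst//; apply: ge0_le_integral => //.
  - by move=> x _; rewrite lee_fin.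
  - exact: mgD.
  - by move=> x; rewrite /= ?in_itv/= lee_fin => /andP[_ /g_mono].
have B1 : ((g c * (b - c))%:E <= \int[leb]_(x in `]c, b]) (g x)%:E)%E.
  rewrite -integral_itv_cst//; apply: ge0_le_integral => //.
  - by move=> x _; rewrite lee_fin.
  - exact: mgD.
  - by move=> x; rewrite /= ?in_itv/= lee_fin => /andP[/ltW/g_mono].
move: (\int[leb]_(x in `]a, c]) (g x)%:E)%E A0 A1 => A A0 A1.
move: (\int[leb]_(x in `]c, b]) (g x)%:E)%E B1 => B B1.
have gc := g0 c.
case: A A0 A1 => [A| |] // A0; rewrite lee_fin => A1.
(* The integral up to a may be infinite, in which case the right-hand side is infinite too. *)
move: (I0 a); case: (I a) => [J| |] // J0; last first.
  have E1 : ((1 - t)%:E * +oo = +oo)%E by rewrite gt0_muley// lte_fin.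
  rewrite E1; apply: (le_trans (leey _)); rewrite -[leLHS]adde0 leeD2l//.
  apply: mule_ge0; first by rewrite lee_fin ltW.
  apply: adde_ge0 => //; apply: adde_ge0 => //.
  by apply: le_trans B1; rewrite lee_fin mulr_ge0// subr_ge0.
rewrite -EFinD -EFinM; apply: (@le_trans _ _
    (((1 - t) * J)%:E + t%:E * ((J + A) + g c * (b - c))%:E)%E); last first.
  apply: leeD => //; apply: lee_wpmul2l; first by rewrite lee_fin ltW.
  by rewrite addeA EFinD leeD2l.
rewrite -EFinM -EFinD lee_fin.
have h1 : c - a = t * (b - a) by rewrite /c; ring.
have h2 : b - c = (1 - t) * (b - a) by rewrite /c; ring.
move: A1; rewrite h1 h2 => A1.
have : (1 - t) * A <= (1 - t) * (g c * (t * (b - a))) by rewrite ler_pM2l.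
lra.
Qed.

Lemma primitive_convex (a b t : R) : 0 < t -> t < 1 ->
  (I ((1 - t) * a + t * b)%R <= (1 - t)%:E * I a + t%:E * I b)%E.
Proof.
move=> t0 t1; have [ab|/ltW ba] := leP a b; first exact: primitive_convex_le.
have := @primitive_convex_le b a (1 - t).
rewrite subr_gt0 gtrBl subKr addrC [in X in _ -> _ -> _ -> X]addeC.
exact.
Qed.

End monotone_primitive.

Section integration_along_lines.
Context {R : realType} {k : nat}.
Local Notation V := 'rV[R]_k.+2.
Local Notation leb := (@lebesgue_measure R).
Local Notation mu := (lebesgue_rV k.+2).

(** A volume preserving change of coordinates that makes e the first basis vector, so that Fubini's
    theorem integrates along the lines parallel to e. The matrix is block triangular, and the entry
    inverse to the first coordinate of e brings the determinant back to 1. *)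
Lemma exists_SL_first_row (e : V) : e ord0 ord0 != 0 ->
  exists2 A : 'M[R]_k.+2, \det A = 1 & forall s p,
    cons_rV (s, p) *m A = s *: e + cons_rV (0, p) *m A.
Proof.
move=> e0; pose a := e ord0 ord0; pose b := (uncons_rV e).2.
pose D : 'M[R]_k.+1 := diag_mx (\row_j if j == ord0 then a^-1 else 1).
have eE : e = row_mx a%:M b :> 'rV_(1 + k.+1).
  by rewrite -cons_rV_row_mx -[LHS]uncons_rVK.
exists (block_mx a%:M b 0 D : 'M[R]_(1 + k.+1)).
  rewrite [LHS](@det_ublock R 1 k.+1) det_scalar1 det_diag (bigD1 ord0)//= mxE eqxx.
  rewrite big1 ?mulr1 ?divff// => i /negPf i0; by rewrite mxE i0.
move=> s p; rewrite !cons_rV_row_mx [in RHS]eE.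
have M u : row_mx u%:M p *m block_mx a%:M b 0 D =
    row_mx (u * a)%:M (u *: b + p *m D) :> 'rV_(1 + k.+1).
  by rewrite mul_row_block mulmx0 addr0 mul_scalar_mx scale_scalar_mx mul_scalar_mx.
have S : s *: row_mx a%:M b + row_mx (0 * a)%:M (0 *: b + p *m D) =
    row_mx (s * a)%:M (s *: b + p *m D) :> 'rV_(1 + k.+1).
  rewrite scale_row_mx add_row_mx scale_scalar_mx.
  by rewrite mul0r scale0r add0r raddf0 addr0.
by rewrite [LHS]M [X in _ = _ + X]M; exact/esym/S.
Qed.

Lemma integral_lines (A : 'M[R]_k.+2) (h : V -> \bar R) : \det A = 1 ->
  measurable_fun setT h -> (forall x, 0 <= h x)%E ->
  (\int[mu]_x h x = \int[lebesgue_rV k.+1]_p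
    \int[leb]_s h (cons_rV (s, p) *m A))%E.
Proof.
move=> A1 mh h0.
have mhA : measurable_fun setT (fun x : V => h (x *m A)).
  by apply: (measurableT_comp mh); exact: measurable_mulmx.
rewrite -(ge0_integral_measure_preserving (lebesgue_rV_SL A1) (D := setT) (h := h))//.
rewrite preimage_setT.
have := @ge0_integral_pushforward _ _ _ _ R _ (@measurable_cons_rV R k.+1)
  (leb \x lebesgue_rV k.+1)%E setT (fun x => h (x *m A)) measurableT mhA.
move=> /(_ (fun x _ => h0 _)); rewrite preimage_setT => E.
transitivity (\int[(leb \x lebesgue_rV k.+1)%E]_z h (cons_rV z *m A))%E.
  exact: E.
rewrite (fubini_tonelli2 (fun z => h (cons_rV z *m A)))//.
by apply: (measurableT_comp mhA); exact: measurable_cons_rV.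
Qed.

Lemma integral_line_comb (e : V) (f : V -> R) (K0 K1 L : set V) (t : R) :
  e ord0 ord0 != 0 -> 0 < t -> t < 1 ->
  measurable_fun setT f -> (forall x, 0 <= f x) ->
  (forall x u, 0 <= u -> f x <= f (x + u *: e)) ->
  measurable K0 -> measurable K1 -> measurable L ->
  (forall x, exists a b : R, [/\ forall s, K0 (x + s *: e) <-> a < s,
      forall s, K1 (x + s *: e) <-> b < s
    & forall s, L (x + s *: e) <-> (1 - t) * a + t * b < s]) ->
  (\int[mu]_(x in ~` L) (f x)%:E <=
   (1 - t)%:E * (\int[mu]_(x in ~` K0) (f x)%:E) +
   t%:E * (\int[mu]_(x in ~` K1) (f x)%:E))%E.
Proof.
move=> e0 t0 t1 mf f0 f_mono mK0 mK1 mL lines.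
have [A A1 AE] := exists_SL_first_row e0.
have t1' : 0 < 1 - t by rewrite subr_gt0.
pose F (K : set V) := (fun x => (f x)%:E) \_ (~` K).
have F0 K x : (0 <= F K x)%E.
  by rewrite /F patchE; case: ifP => // _; rewrite lee_fin.
have mF K : measurable K -> measurable_fun setT (F K).
  move=> mK; apply/(measurable_restrictT _ (measurableC mK)).
  by apply/measurable_EFinP; exact: measurable_funTS.
pose J K p := (\int[leb]_s F K (cons_rV (s, p) *m A))%E.
have IE K : measurable K ->
    (\int[mu]_(x in ~` K) (f x)%:E = \int[lebesgue_rV k.+1]_p J K p)%E.
  move=> mK; by rewrite integral_mkcond (integral_lines A1 (mF _ mK)).
have J0 K p : (0 <= J K p)%E by apply: integral_ge0 => s _; exact: F0.
have mFA K : measurable K -> measurable_fun setT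
    (fun z : measurableTypeR R * 'rV[R]_k.+1 => F K (cons_rV z *m A)).
  move=> mK; apply: (measurableT_comp (mF _ mK)).
  by apply: (measurableT_comp (measurable_mulmx A)); exact: measurable_cons_rV.
have mJ K : measurable K -> measurable_fun setT (J K).
  move=> mK.
  apply: (measurable_fun_fubini_tonelli_G (m1 := leb)
    (fun z : measurableTypeR R * 'rV[R]_k.+1 => F K (cons_rV z *m A))) => //.
  exact: mFA.
rewrite !IE// -!ge0_integralZl//; try exact: mJ; try by rewrite lee_fin ltW.
rewrite -ge0_integralD//; last 4 first.
- by move=> p _; rewrite mule_ge0// lee_fin ltW.
- by apply: measurable_funeM; exact: mJ.
- by move=> p _; rewrite mule_ge0// lee_fin ltW.
- by apply: measurable_funeM; exact: mJ.
apply: ge0_le_integral => //.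
- exact: mJ.
- by apply: emeasurable_funD; apply: measurable_funeM; exact: mJ.
move=> p _; set x := cons_rV (0, p) *m A.
have [a [b [K0a K1b Lab]]] := lines x.
pose g s := f (x + s *: e).
have JE K c : (forall s, K (x + s *: e) <-> c < s) ->
    J K p = (\int[leb]_(s in `]-oo, c]) (g s)%:E)%E.
  move=> Kc; rewrite [RHS]integral_mkcond; apply: eq_integral => s _.
  rewrite /F !patchE AE -/x addrC; congr (if _ then _ else _).
  apply/idP/idP; rewrite !inE /= in_itv/= leNgt.
    by move=> nK; apply/negP => cs; apply: nK; apply/Kc.
  by move=> /negP cs /Kc.
rewrite (JE _ _ K0a) (JE _ _ K1b) (JE _ _ Lab).
apply: primitive_convex => //.
- apply: (measurableT_comp mf); apply: measurable_funD_rV => //.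
  apply: measurable_fun_rV => i; under eq_fun do rewrite mxE.
  by apply: measurable_funM => //; exact: measurable_id.
- by move=> s; exact: f0.
- move=> s r sr; rewrite /g (_ : x + r *: e = x + s *: e + (r - s) *: e).
    by apply: f_mono; rewrite subr_ge0.
  rV_ring.
Qed.

End integration_along_lines.

(** * Combinations line by line, and their rigidity *)

Section line_combinations.
Context {R : realType} {n : nat}.
Local Notation V := 'rV[R]_n.
Variable C : set V.
Hypotheses (C_open : open C) (C_cone : convex_cone C) (C_proper : proper_cone C).
Implicit Types (x y z h e : V) (s u t : R) (K : set V).

Lemma domain_line K e : e != 0 -> C e -> C_convex_domain C K ->
  exists a : V -> R, forall x s, K (x + s *: e) <-> a x < s.
Proof.
move=> e0 Ce K_dom.
suff aP x : exists a : R, forall s, K (x + s *: e) <-> a < s.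
  by have /choice[a ?] := aP; exists a.
have [p Kp] : K !=set0 by case: K_dom => -[].
have [r r0 rC] := cone_ball C_open Ce.
(* For this m the vector (x - p) / m is shorter than r, so that x + m e lies in p + C: every line
   parallel to e enters K. *)
pose m := (`|x - p| + 1) / r.
have m0 : 0 < m by rewrite divr_gt0// ltr_wpDl.
have Ky : K (x + m *: e).
  rewrite (_ : _ + _ = p + m *: (e + m^-1 *: (x - p))).
    apply: (domD_cone K_dom) => //; apply: coneZ => //; apply: rC.
    rewrite normrZ gtr0_norm ?invr_gt0// /m invf_div mulrAC.
    by rewrite ltr_pdivrMr ?ltr_wpDl// ltr_pM2l// ltrDl.
  by rewrite scalerDr scalerA divff ?lt0r_neq0// scale1r; rV_ring.
exists (m - past_length K (x + m *: e) e) => s.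
have [ms|sm] := leP m s.
  split=> _.
    by apply: lt_le_trans ms; rewrite gtrBl (past_length_gt0 C_cone C_proper K_dom).
  have [->//|ms'] := eqVneq s m.
  rewrite (_ : x + s *: e = x + m *: e + (s - m) *: e); last by rV_ring.
  by apply: (domD_cone K_dom) => //; apply: coneZ; rewrite // subr_gt0 lt_neqAle eq_sym ms'.
rewrite (_ : x + s *: e = x + m *: e - (m - s) *: e); last by rV_ring.
rewrite -(past_lengthP C_cone C_proper K_dom e0 Ky Ce) ?subr_ge0 1?ltW//.
by split; lra.
Qed.

(** The points (1 - t) P + t P' with P in K0, P' in K1 and P' - P = u e: the parameter u is the
    signed displacement from P to P'. *)
Definition line_comb e t (K0 K1 : set V) := [set x | exists u : R,
  K0 (x - (t * u) *: e) /\ K1 (x + ((1 - t) * u) *: e)].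

Lemma line_combP e t K0 K1 (a b : R) x : 0 < t -> t < 1 ->
  (forall s, K0 (x + s *: e) <-> a < s) -> (forall s, K1 (x + s *: e) <-> b < s) ->
  forall s, line_comb e t K0 K1 (x + s *: e) <-> (1 - t) * a + t * b < s.
Proof.
move=> t0 t1 K0a K1b s.
have E0 u : x + s *: e - (t * u) *: e = x + (s - t * u) *: e by rV_ring.
have E1 u : x + s *: e + ((1 - t) * u) *: e = x + (s + (1 - t) * u) *: e by rV_ring.
split=> [[u [+ +]]|ab].
  rewrite E0 E1 => /K0a au /K1b bu.
  have -> : s = (1 - t) * (s - t * u) + t * (s + (1 - t) * u) by ring.
  by rewrite ltrD// ltr_pM2l// subr_gt0.
(* The excess c is given to both points, which are taken at the parameters a + c and b + c; the
   displacement below is therefore b - a. *)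
pose c := s - ((1 - t) * a + t * b).
have c0 : 0 < c by rewrite subr_gt0.
exists ((s - a - c) / t); rewrite E0 E1; split.
  by apply/K0a; rewrite mulrCA divff ?lt0r_neq0// mulr1; lra.
apply/K1b; rewrite (_ : s + _ = b + c) ?ltrDl//.
by rewrite /c; field; rewrite lt0r_neq0.
Qed.

Lemma line_comb_sub e t K0 K1 : line_comb e t K0 K1 `<=` convex_comb t K0 K1.
Proof.
move=> x [u [Ku0 Ku1]]; exists (x - (t * u) *: e) => //.
by exists (x + ((1 - t) * u) *: e) => //; rV_ring.
Qed.

Lemma open_translate K z : open K -> open [set x | K (x + z)].
Proof.
move=> /openP_norm oK; apply/openP_norm => x /oK[r r0 rK]; exists r => // y xy.
by apply: rK; rewrite (_ : _ - _ = x - y)//; rV_ring.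
Qed.

Lemma line_comb_open e t K0 K1 : open K0 -> open K1 -> open (line_comb e t K0 K1).
Proof.
move=> oK0 oK1; rewrite (_ : line_comb _ _ _ _ = \bigcup_(u in [set: R])
  ([set x | K0 (x + - ((t * u) *: e))] `&` [set x | K1 (x + ((1 - t) * u) *: e)])).
  by apply: bigcup_open => u _; apply: openI; exact: open_translate.
by apply/seteqP; split=> [x [u Ku]|x [u _ Ku]]; exists u.
Qed.

Lemma convex_comb_open t K0 K1 : t < 1 -> open K0 -> open (convex_comb t K0 K1).
Proof.
move=> t1 /openP_norm oK0; apply/openP_norm => _ [P /oK0[r r0 rK] [P' KP' <-]].
have t1' : 0 < 1 - t by rewrite subr_gt0.
exists ((1 - t) * r) => [|y yr]; first by rewrite mulr_gt0.
exists (P + (1 - t)^-1 *: (y - (P + t *: (P' - P)))).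
  apply: rK; rewrite opprD addrA subrr sub0r -scalerN opprB normrZ.
  by rewrite gtr0_norm ?invr_gt0// ltr_pdivrMl.
by exists P' => //; have := lt0r_neq0 t1' => ?; rV_field.
Qed.

Section rigidity.
Variables (K0 K1 : set V) (t : R).
Hypotheses (t0 : 0 < t) (t1 : t < 1).
Hypotheses (K0_dom : C_convex_domain C K0) (K1_dom : C_convex_domain C K1).

Lemma line_comb_cone e x c : line_comb e t K0 K1 x -> C c ->
  line_comb e t K0 K1 (x + c).
Proof.
move=> [u [Ku0 Ku1]] Cc; exists u; split.
  by rewrite addrAC; apply: (domD_cone K0_dom).
by rewrite addrAC; apply: (domD_cone K1_dom).
Qed.

(** The line by line combination is stable under adding C. If it misses x, it misses every y with x
    in y + C, in particular a ball around x - u e; for u small this ball stays in the open set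
    [convex_comb t K0 K1]. *)
Lemma line_comb_gap e : C e -> ~ (convex_comb t K0 K1 `<=` line_comb e t K0 K1) ->
  exists (x : V) (r : R), 0 < r /\ forall y, `|x - y| < r ->
    convex_comb t K0 K1 y /\ ~ line_comb e t K0 K1 y.
Proof.
move=> Ce /existsNP[x /not_implyP[Kx Lx]].
have [r r0 rC] := cone_ball C_open Ce.
have [q q0 qK] := (openP_norm _).1 (convex_comb_open (K1 := K1) t1 (dom_open K0_dom)) _ Kx.
(* The ball of radius u r around x - u e is within u (|e| + r) = q / 2 of x. *)
pose u := q / (2 * (`|e| + r)).
have er0 : 0 < `|e| + r by rewrite ltr_wpDl.
have u0 : 0 < u by rewrite divr_gt0// mulr_gt0.
have uq : u * (`|e| + r) = q / 2 by rewrite /u; field; rewrite lt0r_neq0.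
exists (x - u *: e), (u * r); split; first by rewrite mulr_gt0.
move=> y yr; split.
  apply: qK; rewrite (_ : x - y = u *: e + (x - u *: e - y)); last by rV_ring.
  apply: le_lt_trans (ler_normD _ _) _; rewrite normrZ gtr0_norm//.
  by apply: (@lt_trans _ _ (u * `|e| + u * r)); rewrite ?ltrD2l// -mulrDr uq; lra.
move=> Ly; apply: Lx.
rewrite (_ : x = y + u *: (e + u^-1 *: (x - u *: e - y))).
  apply: line_comb_cone => //; apply: coneZ => //; apply: rC.
  by rewrite normrZ gtr0_norm ?invr_gt0// ltr_pdivrMl.
by rewrite scalerDr scalerA divff ?lt0r_neq0// scale1r; rV_ring.
Qed.

(** K0 and K1 are described by functions a and b giving where the lines parallel to e enter them.
    The inclusion makes (1 - t) a + t b at a combination of x and y at most (1 - t) a(x) + t b(y),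
    even though x and y are unrelated; this bounds the increments of a by those of b in every
    direction, hence also in the opposite one. *)
Lemma line_comb_rigid e : e != 0 -> C e ->
  convex_comb t K0 K1 `<=` line_comb e t K0 K1 ->
  exists c : R, forall x, K0 x <-> K1 (x - c *: e).
Proof.
move=> e0 Ce KL.
have [a aP] := domain_line e0 Ce K0_dom.
have [b bP] := domain_line e0 Ce K1_dom.
have t1' : 0 < 1 - t by rewrite subr_gt0.
have ab x y : (1 - t) * a ((1 - t) *: x + t *: y) + t * b ((1 - t) *: x + t *: y)
    <= (1 - t) * a x + t * b y.
  set z := _ *: x + _; apply/ler_addgt0Pr => r r0.
  have Kxy : convex_comb t K0 K1 (z + ((1 - t) * a x + t * b y + r) *: e).
    exists (x + (a x + r) *: e); first by apply/aP; rewrite ltrDl.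
    exists (y + (b y + r) *: e); first by apply/bP; rewrite ltrDl.
    by rewrite /z; rV_ring.
  by move/KL : Kxy => /(line_combP t0 t1 (aP z) (bP z))/ltW.
have cvx_line K (c : V -> R) x y s : C_convex_domain C K ->
    (forall x s, K (x + s *: e) <-> c x < s) -> 0 < s -> s < 1 ->
    c (s *: x + (1 - s) *: y) <= s * c x + (1 - s) * c y.
  move=> K_dom cP s0 s1; apply/ler_addgt0Pr => r r0; apply/ltW/cP.
  have -> : s *: x + (1 - s) *: y + (s * c x + (1 - s) * c y + r) *: e =
      s *: (x + (c x + r) *: e) + (1 - s) *: (y + (c y + r) *: e) by rV_ring.
  by apply: (dom_cvx K_dom); rewrite ?(ltW s0) ?(ltW s1)//; apply/cP; rewrite ltrDl.
(* Apply [ab] to z - t h and z + (1 - t) h, whose combination is z, and bound a and b at these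
   points by convexity on [z - h, z] and [z, z + h]. *)
have step z h : a z - a (z - h) <= b (z + h) - b z.
  have ha : a (z - t *: h) <= t * a (z - h) + (1 - t) * a z.
    rewrite (_ : z - t *: h = t *: (z - h) + (1 - t) *: z); last by rV_ring.
    exact: (cvx_line K0).
  have hb : b (z + (1 - t) *: h) <= (1 - t) * b (z + h) + (1 - (1 - t)) * b z.
    rewrite (_ : z + (1 - t) *: h = (1 - t) *: (z + h) + (1 - (1 - t)) *: z); last by rV_ring.
    by apply: (cvx_line K1) => //; rewrite gtrBl.
  have := ab (z - t *: h) (z + (1 - t) *: h).
  rewrite (_ : (1 - t) *: _ + _ = z); last by rV_ring.
  have : (1 - t) * a (z - t *: h) <= (1 - t) * (t * a (z - h) + (1 - t) * a z).
    by rewrite ler_pM2l.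
  have : t * b (z + (1 - t) *: h) <= t * ((1 - t) * b (z + h) + (1 - (1 - t)) * b z).
    by rewrite ler_pM2l.
  move=> h1 h2 h3; have tt : 0 < t * (1 - t) by rewrite mulr_gt0.
  rewrite -(ler_pM2l tt); lra.
(* Telescoping leaves the increment of b shifted by a single step h, which tends to 0 when the
   subdivision is refined. *)
have sum x h N : a (x + N%:R *: h) - a x <= b (x + N%:R *: h + h) - b (x + h).
  elim: N => [|N IH]; first by rewrite scale0r addr0 !subrr.
  have := step (x + N.+1%:R *: h) h.
  rewrite (_ : x + N.+1%:R *: h - h = x + N%:R *: h); last first.
    by rewrite -natr1; rV_ring.
  rewrite (_ : x + N%:R *: h + h = x + N.+1%:R *: h) in IH; last first.
    by rewrite -natr1; rV_ring.
  lra.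
have [r r0 rC] := cone_ball C_open Ce.
have b_lip x h s : 0 < s -> `|h| < s * r -> b (x + h) <= b x + s.
  move=> s0 hs; apply/ler_addgt0Pr => q q0; apply/ltW/bP.
  rewrite (_ : x + h + (b x + s + q) *: e = x + (b x + q) *: e + s *: (e + s^-1 *: h)).
    apply: (domD_cone K1_dom); first by apply/bP; rewrite ltrDl.
    apply: coneZ => //; apply: rC; rewrite normrZ gtr0_norm ?invr_gt0//.
    by rewrite ltr_pdivrMl.
  by rewrite scalerDr scalerA divff ?lt0r_neq0// scale1r; rV_ring.
(* The segment is cut into N + 1 steps so short that, by [b_lip], the shift by h costs at most s = q
   / 2 at each end. *)
have le x y : a y - a x <= b y - b x.
  apply/ler_addgt0Pr => q q0; pose s := q / 2.
  have s0 : 0 < s by rewrite divr_gt0.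
  have sr : 0 < s * r by rewrite mulr_gt0.
  pose N := Num.bound (`|y - x| / (s * r)).
  have N0 : 0 < N.+1%:R :> R by rewrite ltr0n.
  pose h := N.+1%:R^-1 *: (y - x).
  have hs : `|h| < s * r.
    rewrite /h normrZ gtr0_norm ?invr_gt0// ltr_pdivrMl// -ltr_pdivrMr//.
    apply: lt_le_trans (archi_boundP _) _; first by rewrite divr_ge0// ltW.
    by rewrite ler_nat.
  have := sum x h N.+1.
  rewrite (_ : x + N.+1%:R *: h = y); last first.
    by rewrite /h scalerA divff ?lt0r_neq0// scale1r; rV_ring.
  have := b_lip y h s s0 hs.
  have := b_lip (x + h) (- h) s s0; rewrite normrN addrK => /(_ hs).
  by rewrite /s; lra.
exists (a 0 - b 0) => x.
have abE : a x = b x + (a 0 - b 0) by have := le x 0; have := le 0 x; lra.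
have K0E : K0 x <-> a x < 0 by rewrite -aP scale0r addr0.
rewrite K0E -scaleNr bP; move: (a 0 - b 0) abE => c abE.
by split; lra.
Qed.

End rigidity.

(** K1 is invariant under the difference w of the two translations, so that w and - w are recession
    directions, which properness forbids unless w = 0. *)
Lemma translates_eq K0 K1 e1 e2 (c1 c2 : R) : C_convex_domain C K1 ->
  (forall x, K0 x <-> K1 (x - c1 *: e1)) ->
  (forall x, K0 x <-> K1 (x - c2 *: e2)) -> c1 *: e1 = c2 *: e2.
Proof.
move=> K1_dom E1 E2; pose w := c1 *: e1 - c2 *: e2.
have inv y : K1 y <-> K1 (y + w).
  rewrite (_ : y + w = y + c1 *: e1 - c2 *: e2); last by rewrite /w; rV_ring.
  by rewrite -E2 E1 addrK.
have invk (N : nat) y : K1 y <-> K1 (y + N%:R *: w).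
  elim: N => [|N IH]; first by rewrite scale0r addr0.
  rewrite IH inv (_ : y + N%:R *: w + w = y + N.+1%:R *: w)//.
  by rewrite -natr1; rV_ring.
have mid y (N : nat) s z : K1 y -> K1 (y + N%:R *: z) -> 0 <= s -> s < N%:R ->
    K1 (y + s *: z).
  move=> Ky KN s0 sN; have N0 : 0 < N%:R :> R by exact: le_lt_trans sN.
  rewrite (_ : y + s *: z = (s / N%:R) *: (y + N%:R *: z) + (1 - s / N%:R) *: y).
    by apply: (dom_cvx K1_dom) => //; rewrite ?divr_ge0 ?ler_pdivrMr ?mul1r// ltW.
  by have := lt0r_neq0 N0; move: (N%:R) => M M0; rV_field.
have Cw : closure C w.
  apply/(dom_recession K1_dom) => y Ky s s0.
  by apply: (mid y (Num.bound s)) => //; [rewrite -invk|exact: archi_boundP].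
have CNw : closure C (- w).
  apply/(dom_recession K1_dom) => y Ky s s0.
  apply: (mid y (Num.bound s)) => //; last exact: archi_boundP.
  by apply/(invk (Num.bound s)); rewrite scalerN subrK.
by have /eqP := closure_cone_pointed C_cone C_proper Cw CNw; rewrite subr_eq0 => /eqP.
Qed.

End line_combinations.

Lemma countable_bigcap_measurable d (T : measurableType d) (I : choiceType)
    (A : set I) (F : I -> set T) : countable A ->
  (forall i, A i -> measurable (F i)) -> measurable (\bigcap_(i in A) F i).
Proof.
move=> cA mF; have [->|/set0P A0] := eqVneq A set0; first by rewrite bigcap_set0.
have [e [P [eA _]]] := countable_enum cA A0.
rewrite -eA bigcap_image bigcap_mkcond; apply: bigcapT_measurable => k.
by case: ifPn => // /set_mem Pk; apply: mF; rewrite -eA; exists k.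
Qed.

Lemma finite_set_argmin d (T : orderType d) (I : choiceType) (A : set I)
    (f : I -> T) : finite_set A -> A !=set0 ->
  exists2 i, A i & forall j, A j -> (f i <= f j)%O.
Proof.
move=> /finite_seqP[s ->]; elim: s => [[]//|a s IH] _.
have [s0|/set0P s0] := eqVneq [set` s] set0.
  exists a => [|j /=]; first exact: mem_head.
  rewrite inE => /orP[/eqP->//|js].
  by have : [set` s] j by []; rewrite s0.
have [i si iP] := IH s0; have [ai|ia] := leP (f a) (f i).
  exists a => [|j /=]; first exact: mem_head.
  by rewrite inE => /orP[/eqP->//|/iP]; exact: le_trans.
exists i => [|j /=]; first by rewrite /= inE si orbT.
by rewrite inE => /orP[/eqP->|/iP//]; exact: ltW.
Qed.

Section lexicographic.
Context {R : realType} {n : nat}.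

Definition lexi_rV (x : 'rV[R]_n) : n.-tuplelexi R := [tuple x ord0 i | i < n].

Lemma lexi_rV_inj : injective lexi_rV.
Proof.
move=> x y xy; apply/rowP => i.
by have := congr1 (fun t : n.-tuple R => tnth t i) xy; rewrite /lexi_rV !tnth_mktuple.
Qed.

Lemma measurable_lexi_le d (T : measurableType d) (f g : T -> 'rV[R]_n) :
  measurable_fun setT f -> measurable_fun setT g ->
  measurable [set x | (lexi_rV (f x) <= lexi_rV (g x))%O].
Proof.
move=> mf mg.
have mc (h : T -> 'rV[R]_n) i : measurable_fun setT h ->
    measurable_fun setT (fun x => h x ord0 i : measurableTypeR R).
  by move=> mh; apply: (measurableT_comp (@measurable_coord R n i)).
(* Here k is the first index where the coordinates differ, and k = n stands for equality. *)
pose S (k : 'I_n.+1) := \bigcap_(i in [set i : 'I_n | (i <= k)%N])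
  [set x | f x ord0 i <= g x ord0 i ?= iff (i != k :> nat)].
rewrite (_ : [set x | _] = \bigcup_(k in [set: 'I_n.+1]) S k).
  apply: fin_bigcup_measurable => // k _.
  apply: fin_bigcap_measurable => // i _.
  rewrite (_ : [set x | _] = ((fun x => f x ord0 i <= g x ord0 i) @^-1` [set true])
    `&` ((fun x => f x ord0 i == g x ord0 i) @^-1` [set (i != k :> nat)])).
    apply: measurableI; rewrite -[X in measurable X]setTI.
      by apply: measurable_fun_ler => //; exact: mc.
    by apply: measurable_fun_eqr => //; exact: mc.
  by apply/seteqP; split=> x; rewrite /Order.leif/=; case.
apply/seteqP; split=> x /=.
  move/lexi_tupleP => [k kP]; exists k => // i ik /=.
  by have := kP i ik; rewrite /lexi_rV !tnth_mktuple.
move=> [k _ kP]; apply/lexi_tupleP; exists k => i ik.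
by rewrite /lexi_rV !tnth_mktuple; exact: kP.
Qed.

End lexicographic.

(** * Affine deformations *)

(** Valid for all x and q, because [sup] takes the value 0 on sets without supremum. *)
Lemma past_length_ge0 {R : realType} {n : nat} (D : set 'rV[R]_n) x q :
  0 <= past_length D x q.
Proof.
rewrite /past_length; set S := [set s | _].
have [hs|/sup_out->//] := pselect (has_sup S).
by case: hs => -[s Ss] ub; apply: le_trans (ub_le_sup ub Ss); case: Ss.
Qed.

Section affine_deformation.
Context {R : realType} {n : nat}.
Local Notation V := 'rV[R]_n.
Variables (C D : set V) (Gam : set 'M[R]_n) (Gamt : set (@affine_map R n)).
Hypotheses (n_gt0 : (0 < n)%N).
Hypotheses (C_open : open C) (C_cone : convex_cone C) (C_proper : proper_cone C).
Hypotheses (Gam_SL : is_subgroup_SL Gam) (Gam_div : divides Gam C).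
Hypothesis Gamt_def : affine_deformation Gam Gamt.
Hypothesis D_tau : tau_convex_domain C Gamt D.
Implicit Types (x y v w e q : V) (s r : R) (g h : @affine_map R n).

Let D_dom : C_convex_domain C D. Proof. by case: D_tau. Qed.

Let C_neq0 q : C q -> q != 0.
Proof. exact: cone_mem_neq0 n_gt0 C_open C_cone C_proper q. Qed.

Let lenP x q s : D x -> C q -> 0 <= s ->
  (s < past_length D x q) <-> D (x - s *: q).
Proof. by move=> Dx Cq; apply: (past_lengthP C_cone C_proper) => //; exact: C_neq0. Qed.

Let len_gt0 x q : D x -> C q -> 0 < past_length D x q.
Proof. by move=> Dx Cq; apply: (past_length_gt0 C_cone C_proper) => //; exact: C_neq0. Qed.

Lemma gamt_lin g : Gamt g -> Gam g.1.
Proof. by case: Gamt_def => _ [fst_fun _ _]; exact: fst_fun. Qed.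

Lemma gamt_inj g h : Gamt g -> Gamt h -> g.1 = h.1 -> g = h.
Proof. by case: Gamt_def => _ [_ inj _] Gg Gh; apply: inj; apply: mem_set. Qed.

Lemma gamt_det g : Gamt g -> \det g.1 = 1.
Proof. by case: Gamt_def => -[+ _ _ _] _; exact. Qed.

Lemma gamt_unit g : Gamt g -> g.1 \in unitmx.
Proof. by move/gamt_det => g1; rewrite unitmxE g1 unitr1. Qed.

Lemma gamt_inv g : Gamt g -> Gamt (aff_inv g).
Proof. by case: Gamt_def => -[_ _ _ +] _; exact. Qed.

Lemma gamt_id : Gamt (@aff_id R n).
Proof. by case: Gamt_def => -[]. Qed.

Lemma gamt_comp g h : Gamt g -> Gamt h -> Gamt (aff_comp g h).
Proof. by case: Gamt_def => -[_ _ + _] _; exact. Qed.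

Lemma gamt_actK g x : Gamt g -> aff_act (aff_inv g) (aff_act g x) = x.
Proof. by move=> Gg; rewrite aff_act_inv// gamt_det. Qed.

Lemma gamt_actVK g x : Gamt g -> aff_act g (aff_act (aff_inv g) x) = x.
Proof.
move=> Gg; rewrite /aff_act /= mulmxBl mulmxKV ?gamt_unit//.
by rewrite mulmxKV ?gamt_unit// subrK.
Qed.

Lemma invariant_act K g x : invariant_under aff_act Gamt K -> Gamt g ->
  K (aff_act g x) <-> K x.
Proof.
move=> inv Gg; split=> Kx; last by rewrite -(inv _ Gg); exists x.
rewrite -(gamt_actK x Gg) -(inv _ (gamt_inv Gg)).
by exists (aff_act g x).
Qed.

Lemma domain_act g x : Gamt g -> D (aff_act g x) <-> D x.
Proof. by apply: invariant_act; case: D_tau. Qed.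

Lemma gamt_cone g q : Gamt g -> C q -> C (q *m g.1).
Proof. by move=> /gamt_lin GA Cq; exact: (gam_cone Gam_div). Qed.

Lemma past_length_act g x q : Gamt g ->
  past_length D (aff_act g x) (q *m g.1) = past_length D x q.
Proof.
move=> Gg; rewrite /past_length; congr sup; apply/seteqP.
have E s : aff_act g x - s *: (q *m g.1) = aff_act g (x - s *: q).
  by rewrite /aff_act mulmxBl -scalemxAl addrAC.
by split=> s /= [s0]; rewrite E => /(domain_act _ Gg).
Qed.

(** * The unfolding weight, freeness and countability *)

Definition weight_sum e x :=
  (\esum_(g in Gamt) ((past_length D x (e *m g.1)) ^+ n)%:E)%E.

(** Up to the factor (r / 2)^n, the term of g is the volume of [W g], the set of the x - l g (o g)
    with o in a box around e. These sets are pairwise disjoint by [gam_disjoint_cones] and uniformly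
    bounded by [dom_past_bounded], so the volume of one large box bounds the sum. *)
Lemma weight_sum_fin e x : C e -> D x -> (weight_sum e x < +oo)%E.
Proof.
move=> Ce Dx.
have [r r0 [rC rdisj]] := gam_disjoint_cones n_gt0 C_open C_cone C_proper Gam_div Ce.
have [M MP] := dom_past_bounded C_cone C_proper D_dom x.
(* With a quarter of the past length, x - 2 l (e g) is still in D; adding l ((2 e - o) g), which is
   in C, shows that x - l (o g) is in D. *)
pose l g := past_length D x (e *m g.1) / 4.
have l0 g : Gamt g -> 0 < l g.
  move=> Gg; rewrite divr_gt0//.
  apply: len_gt0 => //; exact: gamt_cone.
pose W g := [set y | box (- (l g *: e)) (l g * r) ((- x + y) *m invmx g.1)].
have WP g y : Gamt g -> W g y ->
    exists2 o, `|e - o| <= r & y = x - l g *: (o *m g.1).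
  move=> Gg /boxP => /(_ (mulr_ge0 (ltW (l0 _ Gg)) (ltW r0))) yb.
  exists (- ((l g)^-1 *: ((- x + y) *m invmx g.1))).
    rewrite -(ler_pM2l (l0 _ Gg)) -[X in X * `|_|]gtr0_norm ?l0// -normrZ.
    rewrite opprK scalerDr scalerA divff ?lt0r_neq0 ?l0// scale1r.
    by rewrite -normrN opprD.
  rewrite mulNmx scalerN opprK -scalemxAl scalerA divff ?lt0r_neq0 ?l0// scale1r.
  by rewrite mulmxKV ?gamt_unit// addrA subrr add0r.
have mW g : Gamt g -> measurable (W g) /\
    lebesgue_rV n (W g) = ((2 * (l g * r)) ^+ n)%:E.
  move=> Gg; have lr0 : 0 <= l g * r by rewrite mulr_ge0// ltW// l0.
  pose f := (fun y : V => y *m invmx g.1) \o (fun y : V => - x + y).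
  have pf : measure_preserving (lebesgue_rV n) f.
    apply: measure_preserving_comp; last exact: lebesgue_rV_translation.
    by apply: lebesgue_rV_SL; rewrite det_inv gamt_det// invr1.
  have mB := measurable_box (- (l g *: e)) (l g * r).
  split; first by case: pf => mf _; rewrite -[X in measurable X]setTI; exact: mf.
  by rewrite -(lebesgue_rV_cube (- (l g *: e)))// -(pf.2 _ mB).
have Wb g y : Gamt g -> W g y -> `|y| <= `|x| + M.
  move=> Gg /(WP _ _ Gg)[a eo yE]; rewrite yE.
  apply: le_trans (ler_normB _ _) _; rewrite lerD2l.
  have Co : C (a *m g.1) by apply: gamt_cone => //; exact: rC.
  apply: MP; first by apply: subset_closure; apply: coneZ; rewrite ?l0.
  rewrite (_ : _ - _ = x - (2 * l g) *: (e *m g.1) + l g *: ((2 *: e - a) *m g.1)).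
    apply: (domD_cone D_dom).
      apply/lenP => //; first exact: gamt_cone.
        by rewrite mulr_ge0// ltW// l0.
      by have := l0 _ Gg; rewrite /l; lra.
    apply: coneZ; rewrite ?l0//; apply: gamt_cone => //; apply: rC.
    rewrite (_ : _ - _ = - (e - a)) ?normrN//; rV_ring.
  rewrite mulmxBl -scalemxAl; rV_ring.
(* A common point of [W g] and [W h] would make o (g h^-1) proportional to o' for two vectors o and
   o' near e. *)
have triv : trivIset Gamt W.
  move=> g h Gg Gh [y [/(WP _ _ Gg)[a eo ->] /(WP _ _ Gh)[b eo']]].
  move=> /addrI/oppr_inj E; apply: contrapT => gh.
  have GA : Gam (g.1 *m invmx h.1).
    by case: Gam_SL => _ _ GM GV; apply: GM; [|apply: GV]; exact: gamt_lin.
  apply: (rdisj _ GA _ a b (l h / l g) eo eo').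
  - move=> A1; apply/gh/gamt_inj => //.
    by rewrite -[LHS](mulmxKV (gamt_unit Gh)) A1 mul1mx.
  - by rewrite mulf_neq0 ?invr_eq0 ?lt0r_neq0 ?l0.
  apply: (@scalerI _ _ (l g)); rewrite ?lt0r_neq0 ?l0//.
  rewrite scalerA mulrCA divff ?lt0r_neq0 ?l0// mulr1 mulmxA scalemxAl E.
  by rewrite -scalemxAl mulmxK ?gamt_unit.
pose B := box (0 : V) `|(`|x| + M)|.
have bound F : finite_set F -> F `<=` Gamt ->
    (\sum_(g \in F) ((2 * (l g * r)) ^+ n)%:E <= lebesgue_rV n B)%E.
  move=> fF FG; have -> : (\sum_(g \in F) ((2 * (l g * r)) ^+ n)%:E)%E =
      (\sum_(g \in F) lebesgue_rV n (W g))%E.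
    by apply: eq_fsbigr => g /set_mem/FG/mW[].
  rewrite -measure_fin_bigcup//; last 2 first.
  - exact: sub_trivIset triv.
  - by move=> g /FG/mW[].
  apply: le_measure; rewrite ?inE.
  - by apply: fin_bigcup_measurable => // g /FG/mW[].
  - exact: measurable_box.
  - move=> y [g /FG Gg Wy]; apply/boxP => //; rewrite sub0r normrN.
    by apply: le_trans (Wb _ _ Gg Wy) (ler_norm _).
have c0 : 0 < (r / 2) ^+ n by rewrite exprn_gt0// divr_gt0.
apply: (@le_lt_trans _ _ (((r / 2) ^- n)%:E * lebesgue_rV n B)%E); last first.
  by rewrite /B lebesgue_rV_cube// -EFinM ltry.
apply: ge_ereal_sup => _ [F [fF FG] <-].
rewrite -(@lee_pmul2l _ ((r / 2) ^+ n)%:E)//.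
rewrite muleA -EFinM divff ?lt0r_neq0// mul1e.
apply: le_trans (bound _ fF FG).
rewrite ge0_mule_fsumr; last first.
  by move=> g; rewrite lee_fin exprn_ge0// past_length_ge0.
rewrite le_eqVlt; apply/orP; left; apply/eqP; apply: eq_fsbigr => g _.
by rewrite -EFinM -exprMn /l; congr (_ ^+ _)%:E; field.
Qed.

(** A convergent sum has only finitely many terms above r^n. *)
Lemma past_length_finite e x r : C e -> D x -> 0 < r ->
  finite_set [set g | Gamt g /\ r <= past_length D x (e *m g.1)].
Proof.
move=> Ce Dx r0; apply: contrapT => inf.
have := weight_sum_fin Ce Dx.
have G0 : (0 <= weight_sum e x)%E.
  by apply: esum_ge0 => g _; rewrite lee_fin exprn_ge0// past_length_ge0.
case E : (weight_sum e x) => [S| |] // _; last by rewrite E in G0.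
have rn0 : 0 < r ^+ n by rewrite exprn_gt0.
have S0 : 0 <= S by rewrite -lee_fin -E.
have [F FS Fcard] := infinite_set_fset (Num.bound (S / r ^+ n)) inf.
have : (weight_sum e x < (Num.bound (S / r ^+ n))%:R%:E * (r ^+ n)%:E)%E.
  rewrite E -EFinM lte_fin -ltr_pdivrMr//; apply: archi_boundP.
  by rewrite divr_ge0// ltW.
apply/negP; rewrite -leNgt.
apply: (@le_trans _ _ (\sum_(g \in [set` F]) (r ^+ n)%:E)%E).
  rewrite fsbig_finite//= set_fsetK sumEFin big_const_seq count_predT.
  rewrite iter_addr_0 -EFinM lee_fin -[X in _ <= X]mulr_natl.
  rewrite ler_wpM2r ?ler_nat//.
  exact: ltW.
rewrite /weight_sum; apply: (@le_trans _ _ (\sum_(g \in [set` F])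
    ((past_length D x (e *m g.1)) ^+ n)%:E)%E).
  apply: lee_fsum => // g /FS[_ rg].
  by rewrite lee_fin lerXn2r// nnegrE ?past_length_ge0// ltW.
by apply: esum_ge; exists [set` F] => //; split => // g /FS[].
Qed.

Lemma gamt_countable : countable Gamt.
Proof.
have [e Ce] : C !=set0 by case: C_proper.
have [x Dx] : D !=set0 by case: D_dom => -[].
rewrite (_ : Gamt = \bigcup_k
    [set g | Gamt g /\ k.+1%:R^-1 <= past_length D x (e *m g.1)]).
  apply: bigcup_countable => // k _; apply: finite_set_countable.
  by apply: past_length_finite; rewrite // invr_gt0 ltr0n.
apply/seteqP; split=> [g Gg|g [k _ []//]].
have /ltr_add_invr[k] := len_gt0 Dx (gamt_cone Gg Ce); rewrite add0r => kl.
by exists k => //; split => //; exact: ltW.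
Qed.

(** If g fixes x, all its powers give past lengths at x equal to that of e; these are finitely many,
    so the linear part of g has finite order. It then fixes a vector of C, and freeness on P(C)
    makes it trivial. *)
Lemma gamt_free g x : Gamt g -> D x -> aff_act g x = x -> g = @aff_id R n.
Proof.
move=> Gg Dx gx; have [e Ce] : C !=set0 by case: C_proper.
pose pow k := iter k (aff_comp g) (@aff_id R n).
have powG k : Gamt (pow k).
  by elim: k => [|k IH]; [exact: gamt_id|exact: gamt_comp].
have pow_x k : aff_act (pow k) x = x.
  by elim: k => [|k IH]; rewrite /= ?aff_act_id// aff_act_comp gx.
have pow1 k : (pow k).1 = g.1 ^+ k.
  by elim: k => // k IH; rewrite exprS -IH.
have [i [j [ij pij]]] : exists i j, (i < j)%N /\ pow i = pow j.
  apply: contrapT => no.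
  have := past_length_finite Ce Dx (len_gt0 Dx Ce) => /(finite_preimage (f := pow)) fin.
  apply: infinite_nat; apply: sub_finite_set (fin _) => [k _|].
    split => //=; rewrite -(past_length_act x e (powG k)) pow_x//.
  move=> i j _ _ pij; apply: contrapT => /eqP; rewrite neq_ltn => /orP[ij|ij].
    by apply: no; exists i, j.
  by apply: no; exists j, i.
have Ai1 : g.1 ^+ (j - i) = 1.
  have : g.1 ^+ i *m 1%:M = g.1 ^+ i *m g.1 ^+ (j - i).
    by rewrite mulmx1 -[LHS]pow1 pij pow1 mulmxE -exprD subnKC// ltnW.
  move=> /(congr1 (mulmx (invmx (g.1 ^+ i)))).
  by rewrite !mulKmx// -pow1 gamt_unit.
(* The sum over a period is fixed by g, and convexity keeps it in C. *)
pose v := \sum_(k < j - i) e *m (pow k).1.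
have Cv : C v.
  rewrite /v; move: (subn_gt0 i j); rewrite ij; case: (j - i)%N => // m _.
  have H k : C (e *m (pow k).1) by exact: gamt_cone.
  elim: m => [|m IH]; first by rewrite big_ord1; exact: (H 0%N).
  by rewrite big_ord_recr; apply: coneD => //; exact: (H m.+1).
have vA : v *m g.1 = v.
  have E k : (e *m (pow k).1) *m g.1 = e *m (pow k.+1).1.
    by rewrite -mulmxA !pow1 mulmxE -exprSr.
  rewrite {1}/v mulmx_suml; under eq_bigr do rewrite E.
  rewrite /v; move: (subn_gt0 i j) Ai1; rewrite ij.
  case: (j - i)%N => // m _ Am; rewrite [LHS]big_ord_recr [RHS]big_ord_recl addrC.
  congr (_ + _).
  by rewrite !pow1 Am.
apply: gamt_inj => //; first exact: gamt_id.
case: Gam_div => _ free _ _; apply: (free _ (Defs.proj v)).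
- exact: gamt_lin.
- by exists v.
- by rewrite proj_actE /lin_act vA.
Qed.

#[local] Hint Resolve gamt_id gamt_countable : core.

Lemma gamt_act_preserving g : Gamt g ->
  measure_preserving (lebesgue_rV n) (aff_act g).
Proof. by move/gamt_det; exact: aff_act_preserving. Qed.

Lemma aff_compA (g h k : @affine_map R n) :
  aff_comp (aff_comp g h) k = aff_comp g (aff_comp h k).
Proof. by apply: aff_actI; apply/funext => x; rewrite !aff_act_comp. Qed.

Lemma gamt_compV g : Gamt g -> aff_comp g (aff_inv g) = @aff_id R n.
Proof.
move=> Gg; apply: aff_actI; apply/funext => x.
by rewrite aff_act_comp gamt_actK// aff_act_id.
Qed.

Lemma gamt_compVl g : Gamt g -> aff_comp (aff_inv g) g = @aff_id R n.
Proof.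
move=> Gg; apply: aff_actI; apply/funext => x.
by rewrite aff_act_comp gamt_actVK// aff_act_id.
Qed.

Lemma aff_comp_id g : aff_comp g (@aff_id R n) = g.
Proof. by apply: aff_actI; apply/funext => x; rewrite aff_act_comp aff_act_id. Qed.

Lemma gamt_bij_comp g : Gamt g -> set_bij Gamt Gamt (fun h => aff_comp h g).
Proof.
move=> Gg; split=> [h Gh|h k _ _ /(congr1 (fun f => aff_comp f (aff_inv g)))|h Gh].
- exact: gamt_comp.
- by rewrite !aff_compA gamt_compV// !aff_comp_id.
- exists (aff_comp h (aff_inv g)); first exact/gamt_comp/gamt_inv.
  by rewrite aff_compA gamt_compVl// aff_comp_id.
Qed.

Lemma aff_invK g : Gamt g -> aff_inv (aff_inv g) = g.
Proof.
move=> Gg; rewrite -[LHS]aff_comp_id -(gamt_compVl Gg) -aff_compA.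
rewrite gamt_compVl; last exact: gamt_inv.
by apply: aff_actI; apply/funext => x; rewrite aff_act_comp aff_act_id.
Qed.

Lemma gamt_bij_inv : set_bij Gamt Gamt (@aff_inv R n).
Proof.
split=> [g|g h /set_mem Gg /set_mem Gh gh|g Gg]; first exact: gamt_inv.
  by rewrite -(aff_invK Gg) gh aff_invK.
by exists (aff_inv g); [exact: gamt_inv|exact: aff_invK].
Qed.

Lemma weight_sum_act e x g : Gamt g -> weight_sum e (aff_act g x) = weight_sum e x.
Proof.
move=> Gg; rewrite /weight_sum (reindex_esum Gamt Gamt _ _ (gamt_bij_comp Gg)).
by apply: eq_esum => h Gh; rewrite /= mulmxA past_length_act.
Qed.

Lemma weight_sum_gt0 e x : C e -> D x -> (0 < weight_sum e x)%E.
Proof.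
move=> Ce Dx; apply: (@lt_le_trans _ _ ((past_length D x e) ^+ n)%:E).
  by rewrite lte_fin exprn_gt0// len_gt0.
apply: esum_ge; exists [set @aff_id R n]; first by split=> [|g ->] //; exact: gamt_id.
by rewrite fsbig_set1/= mulmx1.
Qed.

(* Positive on D, and its sum over each orbit is 1, so that integrating it over
   an invariant set gives the volume of the quotient. It is nondecreasing along
   e: adding u e to x multiplies the past length in the direction e by
   (l + u) / l, and those in the other directions by at most this factor. *)
Definition unfold_weight e x : R :=
  if `[< D x >] then (past_length D x e) ^+ n / fine (weight_sum e x) else 0.

Local Notation psi := unfold_weight.

Lemma unfold_weight_ge0 e x : 0 <= psi e x.
Proof.
rewrite /psi; case: ifPn => // _; rewrite divr_ge0 ?exprn_ge0 ?past_length_ge0//.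
apply: fine_ge0; apply: esum_ge0 => g _.
by rewrite lee_fin exprn_ge0// past_length_ge0.
Qed.

Lemma unfold_weight_gt0 e x : C e -> D x -> 0 < psi e x.
Proof.
move=> Ce Dx; rewrite /psi asboolT// divr_gt0 ?exprn_gt0 ?len_gt0//.
by rewrite fine_gt0// weight_sum_gt0// weight_sum_fin.
Qed.

(** By invariance, the length at g x in the direction e is the length at x in the direction e g^-1:
    up to inversion of g, the numerators are the terms of the common denominator. *)
Lemma unfold_weight_sum e x : C e -> D x ->
  (\esum_(g in Gamt) (psi e (aff_act g x))%:E = 1)%E.
Proof.
move=> Ce Dx; have w0 := weight_sum_gt0 Ce Dx.
have wfin : weight_sum e x \is a fin_num.
  by rewrite ge0_fin_numE ?weight_sum_fin// ltW.
have f0 : 0 < fine (weight_sum e x) by rewrite fine_gt0// w0 weight_sum_fin.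
rewrite (eq_esum (b := fun g => ((fine (weight_sum e x))^-1%:E *
    ((past_length D x (e *m (aff_inv g).1)) ^+ n)%:E)%E)); last first.
  move=> g Gg; rewrite /psi asboolT; last exact/domain_act.
  rewrite weight_sum_act// -EFinM mulrC -(past_length_act x (e *m (aff_inv g).1) Gg).
  by rewrite -mulmxA mulVmx ?gamt_unit// mulmx1.
pose a g y : \bar R := ((past_length D y (e *m (aff_inv g).1)) ^+ n)%:E.
have a0 g y : Gamt g -> (0 <= a g y)%E.
  by move=> _; rewrite lee_fin exprn_ge0// past_length_ge0.
rewrite (countable_esumZl gamt_countable a0) ?invr_ge0 ?(ltW f0)//.
rewrite -(reindex_esum Gamt Gamt _ (fun g => ((past_length D x (e *m g.1)) ^+ n)%:E)
  gamt_bij_inv) -/(weight_sum e x) -[X in (_ * X)%E](fineK wfin) -EFinM.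
by rewrite mulVf// gt_eqF.
Qed.

Definition past_length_on q x : R := if `[< D x >] then past_length D x q else 0.

(** For s >= 0 the set where the length exceeds s is the intersection of D with its translate by s
    q, hence open. *)
Lemma measurable_past_length q : C q -> measurable_fun setT (past_length_on q).
Proof.
move=> Cq; apply: (measurability _ (RGenOInfty.measurableE R)) => //.
move=> _ [_ [s ->] <-]; rewrite setTI; have [s0|s0] := leP 0 s.
  have -> : past_length_on q @^-1` `]s, +oo[ = D `&` [set x | D (x - s *: q)].
    apply/seteqP; split=> x /=; rewrite /past_length_on in_itv/= andbT.
      case: asboolP => [Dx|_]; last by rewrite ltNge s0.
      by move/(lenP Dx Cq s0).
    by move=> [Dx Ds]; rewrite asboolT//; apply/lenP.
  apply: open_measurable_rV; apply: openI; first exact: dom_open D_dom.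
  have oD := dom_open D_dom; apply/openP_norm => x Dx.
  have [r r0 rD] := (openP_norm D).1 oD _ Dx; exists r => // y xy.
  by apply: rD; rewrite (_ : _ - _ = x - y)//; rV_ring.
have -> : past_length_on q @^-1` `]s, +oo[ = setT => //.
apply/seteqP; split=> // x _ /=; rewrite /past_length_on in_itv/= andbT.
by case: asboolP => // _; apply: lt_le_trans s0 _; exact: past_length_ge0.
Qed.

Lemma measurable_unfold_weight e : C e -> measurable_fun setT (psi e).
Proof.
move=> Ce.
pose L := past_length_on; have mL := measurable_past_length.
have L0 q x : 0 <= L q x.
  by rewrite /L /past_length_on; case: asboolP => // _; exact: past_length_ge0.
pose W x : \bar R := (\esum_(g in Gamt) ((L (e *m g.1) x) ^+ n)%:E)%E.
have mW : measurable_fun setT W.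
  apply: measurable_fun_esum => // [g x Gg|g Gg].
    by rewrite lee_fin exprn_ge0// L0.
  apply/measurable_EFinP; apply: measurable_funX; apply: mL.
  exact: gamt_cone.
have W0 x : (0 <= W x)%E.
  by apply: esum_ge0 => g _; rewrite lee_fin exprn_ge0// L0.
(* Outside D both sides vanish: the length is set to 0 there, and its power has exponent n > 0. *)
rewrite (_ : psi e = fun x => (L e x) ^+ n * (fine (W x)) `^ (-1)).
  apply: measurable_funM; first by apply: measurable_funX; exact: mL.
  apply: (@measurableT_comp _ _ _ _ _ _ (fun r : measurableTypeR R =>
    r `^ (-1) : measurableTypeR R) _ (fun x => fine (W x) : measurableTypeR R)).
    exact: measurable_powR.
  by apply: (@measurableT_comp _ _ _ _ _ _ (@fine R) _ W) => //; exact: fine_measurable.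
apply/funext => x; rewrite powR_inv1 ?fine_ge0// /psi /W /L /past_length_on.
case: asboolP => Dx; last by rewrite expr0n gtn_eqF// mul0r.
by congr (_ * (fine _)^-1); apply: eq_esum => g _; rewrite asboolT.
Qed.

(** Multiply the indicator of U by the sum 1 of the weights over the orbit, exchange sum and
    integral, and carry each term by the volume preserving map g. *)
Lemma unfold_measure e (U : set V) : C e -> measurable U -> U `<=` D ->
  (lebesgue_rV n U =
   \int[lebesgue_rV n]_x
     (\esum_(g in Gamt) (psi e x * \1_U (aff_act (aff_inv g) x))%:E))%E.
Proof.
move=> Ce mU UD.
have mact g : Gamt g -> measurable_fun setT (aff_act g).
  by move=> Gg; have [] := gamt_act_preserving Gg.
have m1 : measurable_fun setT (\1_U : V -> R) by exact: measurable_indic.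
have mpsi := measurable_unfold_weight Ce.
have p0 x y : (0 <= (psi e x * \1_U y)%:E)%E.
  by rewrite lee_fin mulr_ge0// unfold_weight_ge0.
have mh g : Gamt g -> measurable_fun setT
    (fun x => (psi e x * \1_U (aff_act (aff_inv g) x))%:E).
  move=> Gg; apply/measurable_EFinP; apply: measurable_funM => //.
  by apply: (measurableT_comp m1); apply: mact; exact: gamt_inv.
rewrite integral_esum//; try exact: gamt_countable.
transitivity (\esum_(g in Gamt)
    \int[lebesgue_rV n]_x (psi e (aff_act g x) * \1_U x)%:E)%E; last first.
  apply: eq_esum => g Gg.
  rewrite -(ge0_integral_measure_preserving (gamt_act_preserving Gg) (D := setT)
    (h := fun x => (psi e x * \1_U (aff_act (aff_inv g) x))%:E))//.
    by rewrite preimage_setT; apply: eq_integral => x _; rewrite gamt_actK.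
  exact: mh.
rewrite -integral_esum//; try exact: gamt_countable; last first.
  move=> g Gg; apply/measurable_EFinP; apply: measurable_funM => //.
  by apply: (measurableT_comp mpsi); exact: mact.
transitivity (\int[lebesgue_rV n]_x (\1_U x)%:E)%E.
  by rewrite integral_indic// setIT.
apply: eq_integral => x _; rewrite indicE; case: (boolP (x \in U)) => [|_].
  rewrite inE => /UD Dx; rewrite -(unfold_weight_sum Ce Dx).
  by apply: eq_esum => g _; rewrite mulr1.
by rewrite esum1// => g _; rewrite mulr0.
Qed.

(** For each x at most one g brings a point of U to x, by injectivity on orbits and freeness: the
    sum in [unfold_measure] is at most the weight of x, and it is zero off E. *)
Lemma measure_le_unfold e (U E : set V) : C e -> measurable U -> U `<=` D ->
  measurable E -> set_inj U (orbit_of aff_act Gamt) ->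
  (forall u g, U u -> Gamt g -> E (aff_act g u)) ->
  (lebesgue_rV n U <= \int[lebesgue_rV n]_(x in E) (psi e x)%:E)%E.
Proof.
move=> Ce mU UD mE Uinj UE; rewrite (unfold_measure Ce mU UD).
have m1 : measurable_fun setT (\1_U : V -> R) by exact: measurable_indic.
rewrite [leRHS]integral_mkcond; apply: ge0_le_integral => //.
- move=> x _; apply: esum_ge0 => g _.
  by rewrite lee_fin mulr_ge0// unfold_weight_ge0.
- apply: measurable_fun_esum.
  + exact: gamt_countable.
  + by move=> g x _; rewrite lee_fin mulr_ge0// unfold_weight_ge0.
  + move=> g Gg; apply/measurable_EFinP; apply: measurable_funM.
      exact: measurable_unfold_weight.
    apply: (measurableT_comp m1).
    by have [] := gamt_act_preserving (gamt_inv Gg).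
- apply/(measurable_restrictT _ mE)/measurable_EFinP.
  by apply: measurable_funTS; exact: measurable_unfold_weight.
move=> x _; have [[g0 [Gg0 Ug0]]|no] :=
    pselect (exists g0, Gamt g0 /\ U (aff_act (aff_inv g0) x)); last first.
  rewrite esum1.
    by rewrite patchE; case: ifP => // _; rewrite lee_fin unfold_weight_ge0.
  move=> g Gg; rewrite indicE memNset ?mulr0// => Ug.
  by apply: no; exists g.
rewrite (esumID [set g0]); last first.
  by move=> g _; rewrite lee_fin mulr_ge0// unfold_weight_ge0.
rewrite [X in (_ + X)%E]esum1 ?adde0.
  rewrite setIC (_ : _ `&` _ = [set g0]); last first.
    by apply/seteqP; split => [g []//|g ->].
  rewrite esum_set1; last by rewrite lee_fin mulr_ge0// unfold_weight_ge0.
  rewrite patchE mem_set ?indicE ?mem_set ?mulr1//.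
  by rewrite -(gamt_actVK x Gg0); exact: UE.
move=> g [Gg /= gg0]; rewrite indicE memNset ?mulr0// => Ug; apply: gg0.
have E1 : aff_act (aff_inv g) x = aff_act (aff_inv g0) x.
  apply: Uinj; rewrite ?inE//.
  have orb h : Gamt h -> orbit_of aff_act Gamt (aff_act (aff_inv h) x) =
      orbit_of aff_act Gamt x.
    move=> Gh; apply/seteqP; split=> _ [k Gk <-].
      exists (aff_comp (aff_inv h) k); last by rewrite aff_act_comp.
      by apply: gamt_comp => //; exact: gamt_inv.
    exists (aff_comp h k); first exact: gamt_comp.
    by rewrite aff_act_comp gamt_actVK.
  by rewrite !orb.
have : aff_comp g0 (aff_inv g) = @aff_id R n.
  apply: (@gamt_free _ (aff_act (aff_inv g0) x)).
  - by apply: gamt_comp => //; exact: gamt_inv.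
  - exact: UD.
  - by rewrite aff_act_comp gamt_actVK.
move=> /(congr1 (fun f => aff_comp f g)).
rewrite aff_compA (gamt_compVl Gg) aff_comp_id => ->.
by apply: aff_actI; apply/funext => y; rewrite aff_act_comp aff_act_id.
Qed.

(** Dually, each x of E is reached from U by at least one g. *)
Lemma unfold_le_measure e (U E : set V) : C e -> measurable U -> U `<=` D ->
  measurable E -> E `<=` \bigcup_(g in Gamt) (aff_act g @` U) ->
  (\int[lebesgue_rV n]_(x in E) (psi e x)%:E <= lebesgue_rV n U)%E.
Proof.
move=> Ce mU UD mE EU; rewrite (unfold_measure Ce mU UD).
have m1 : measurable_fun setT (\1_U : V -> R) by exact: measurable_indic.
have p0 g x : Gamt g -> (0 <= (psi e x * \1_U (aff_act (aff_inv g) x))%:E)%E.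
  by move=> _; rewrite lee_fin mulr_ge0// unfold_weight_ge0.
rewrite [leLHS]integral_mkcond; apply: ge0_le_integral => //.
- by move=> x _; rewrite patchE; case: ifP => // _; rewrite lee_fin unfold_weight_ge0.
- apply/(measurable_restrictT _ mE)/measurable_EFinP.
  by apply: measurable_funTS; exact: measurable_unfold_weight.
- apply: (measurable_fun_esum gamt_countable p0).
  move=> g Gg; apply/measurable_EFinP; apply: measurable_funM.
    exact: measurable_unfold_weight.
  apply: (measurableT_comp m1).
  by have [] := gamt_act_preserving (gamt_inv Gg).
move=> x _; rewrite patchE; case: ifP => [|_]; last first.
  by apply: esum_ge0 => g _; rewrite lee_fin mulr_ge0// unfold_weight_ge0.
rewrite inE => /EU[g Gg [u Uu ux]].
apply: esum_ge; exists [set g]; first by split=> // h ->.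
by rewrite fsbig_set1 -ux gamt_actK// indicE mem_set// mulr1.
Qed.

(** * Order intervals of the cone and their volumes *)

Definition order_interval v := [set x | C x /\ C (v - x)].

Lemma order_interval_measurable v : measurable (order_interval v).
Proof.
apply: open_measurable_rV; apply/openP_norm => x [Cx Cvx].
have [r r0 rC] := cone_ball C_open Cx; have [q q0 qC] := cone_ball C_open Cvx.
exists (Num.min r q); first by rewrite lt_min r0.
move=> y; rewrite lt_min => /andP[yr yq]; split.
  rewrite (_ : y = x + - (x - y)); last by rV_ring.
  by apply: rC; rewrite normrN.
by rewrite (_ : v - y = v - x + (x - y)); [exact: qC|rV_ring].
Qed.

(** Since Gam preserves both C and the volume, this volume is a size of v that is constant on
    Gam-orbits. *)
Lemma order_interval_act v (A : 'M[R]_n) : Gam A ->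
  lebesgue_rV n (order_interval (v *m A)) = lebesgue_rV n (order_interval v).
Proof.
move=> GA; have A1 : \det A = 1 by case: Gam_SL => + _ _ _; exact.
rewrite -((lebesgue_rV_SL A1).2 _ (order_interval_measurable _)).
have CA x : C (x *m A) <-> C x.
  by split; [exact: gam_coneV Gam_SL Gam_div _ _ GA|exact: gam_cone Gam_div _ _ GA].
congr (lebesgue_rV n _); apply/seteqP.
by split=> x /=; rewrite /order_interval /= -mulmxBl !CA.
Qed.

Lemma order_interval_fin v : (lebesgue_rV n (order_interval v) < +oo)%E.
Proof.
have [p Dp] : D !=set0 by case: D_dom => -[].
have [M MP] := dom_past_bounded C_cone C_proper D_dom (p + v).
apply: (@bounded_rV_fin _ _ _ M); first exact: order_interval_measurable.
move=> x [Cx Cvx]; apply: MP; first exact: subset_closure.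
by rewrite -addrA; apply: (domD_cone D_dom).
Qed.

(* A volume argument: far translates of e/2 along the cone have order intervals
   of large volume, whereas those of the vectors below a bounded part of the
   orbits have bounded volume. *)
Lemma orbit_coarse e : C e -> exists M : R, forall c, closure C c -> M <= `|c| ->
  exists2 A, Gam A & C (2^-1 *: e + c - e *m A).
Proof.
move=> Ce; have [m m0 mP] := gam_cocompact n_gt0 C_open C_cone C_proper Gam_div Ce.
have [r r0 rC] := cone_ball C_open Ce.
(* For w below m e and s <= m, the vector s w is below (m * m) e: L bounds the volumes of the order
   intervals of such vectors. *)
pose L := fine (lebesgue_rV n (order_interval ((m * m) *: e))).
have LE : lebesgue_rV n (order_interval ((m * m) *: e)) = L%:E.
  by rewrite fineK// ge0_fin_numE// order_interval_fin.
have L0 : 0 <= L by rewrite fine_ge0.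
have r4 : 0 < (r / 4) ^+ n by rewrite exprn_gt0// divr_gt0.
(* N boxes of radius r / 8, each of volume (r / 4)^n, have total volume more than L. *)
pose N := (Num.bound (L / (r / 4) ^+ n)).+1.
have N0 : 0 < N%:R :> R by rewrite ltr0n.
have LN : L < N%:R * (r / 4) ^+ n.
  rewrite -ltr_pdivrMr//; apply: lt_trans (archi_boundP _) _.
    by rewrite divr_ge0// ltW.
  by rewrite ltr_nat.
exists (N%:R * r) => c Cc cN; pose v := 2^-1 *: e + c.
have C4 y : `|y| <= r / 8 -> C (4^-1 *: e + y).
  move=> yr; rewrite (_ : _ + y = 4^-1 *: (e + 4 *: y)); last by rV_lra.
  apply: coneZ => //; apply: rC; rewrite normrZ ger0_norm//.
  by apply: (@le_lt_trans _ _ (4 * (r / 8))); [rewrite ler_pM2l|lra].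
have scaled s : 0 <= s -> closure C (s *: c).
  move=> s0; have [->|sn0] := eqVneq s 0; first by rewrite scale0r; exact: closure_cone0.
  by apply: closure_coneZ => //; rewrite lt0r sn0.
(* Both x and v - x are e / 4, up to an error that C absorbs, plus a part of c. The centres are at
   least r apart as |c| >= N r, so the boxes are disjoint. *)
pose B (j : nat) := box (4^-1 *: e + (j%:R / N%:R) *: c) (r / 8).
have r8 : 0 <= r / 8 by rewrite divr_ge0// ltW.
have BE j : (j < N)%N -> B j `<=` order_interval v.
  move=> jN x /(boxP _ _ r8).
  set y := _ - x => yr.
  have j0 : 0 <= j%:R / N%:R :> R by rewrite divr_ge0 ?ler0n.
  have j1 : j%:R / N%:R <= 1 :> R by rewrite ler_pdivrMr// mul1r ler_nat ltnW.
  split.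
    rewrite (_ : x = 4^-1 *: e + - y + (j%:R / N%:R) *: c); last by rewrite /y; rV_ring.
    by apply: (cone_closureD C_open C_cone); [apply: C4; rewrite normrN|exact: scaled].
  rewrite (_ : v - x = 4^-1 *: e + y + (1 - j%:R / N%:R) *: c).
    by apply: (cone_closureD C_open C_cone); [exact: C4|apply: scaled; rewrite subr_ge0].
  by rewrite /y /v; move: (j%:R / N%:R) => q; rV_lra.
have triv : trivIset `I_N B.
  move=> i j _ _ [x [/(boxP _ _ r8) xi /(boxP _ _ r8) xj]].
  apply: contrapT => /eqP ij.
  have : `|(i%:R / N%:R - j%:R / N%:R) *: c| <= r / 4.
    rewrite (_ : _ *: c = (4^-1 *: e + (i%:R / N%:R) *: c - x) -
        (4^-1 *: e + (j%:R / N%:R) *: c - x)); last by rV_ring.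
    by apply: le_trans (ler_normB _ _) _; lra.
  rewrite normrZ -mulrBl normrM (@gtr0_norm _ N%:R^-1) ?invr_gt0//.
  have : (1 : R) <= `|i%:R - j%:R|.
    wlog ltij : i j {xi xj} ij / (i < j)%N => [hw|].
      move: ij; rewrite neq_ltn => /orP[h|h]; first by apply: hw => //; rewrite ltn_eqF.
      by rewrite distrC; apply: hw => //; rewrite ltn_eqF.
    by rewrite distrC -natrB ?(ltnW ltij)// normr_nat ler1n subn_gt0.
  move=> ij1; apply/negP; rewrite -ltNge.
  apply: (@lt_le_trans _ _ (1 * N%:R^-1 * (N%:R * r))).
    by rewrite mul1r mulKf ?lt0r_neq0//; lra.
  apply: ler_pM => //.
  - by rewrite mulr_ge0// ltW.
  - by rewrite ler_pM2r ?invr_gt0.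
have vol : ((N%:R * (r / 4) ^+ n)%:E <= lebesgue_rV n (order_interval v))%E.
  have -> : ((N%:R * (r / 4) ^+ n)%:E = \sum_(j \in `I_N) lebesgue_rV n (B j))%E.
    rewrite -fsbig_ord (eq_bigr (fun=> ((r / 4) ^+ n)%:E)) => [|j _].
      by rewrite sumEFin sumr_const card_ord mulr_natl.
    by rewrite lebesgue_rV_cube//; congr ((_ ^+ _)%:E); field.
  rewrite -measure_fin_bigcup//; last by move=> j _; exact: measurable_box.
  apply: le_measure; rewrite ?inE.
  - by apply: fin_bigcup_measurable => // j _; exact: measurable_box.
  - exact: order_interval_measurable.
  - by move=> x [j /= jN]; exact: BE.
have Cv : C v by apply: (cone_closureD C_open C_cone) => //; exact: coneZ.
have [A [w [s [GA s0 vE mw1 mw2]]]] := mP v Cv.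
have Cw : C w.
  rewrite -[w](scalerK (lt0r_neq0 m0)); apply: coneZ; rewrite ?invr_gt0//.
  by have := coneD C_cone mw1 Ce; rewrite subrK.
(* Otherwise the order interval of v, equal in volume to that of s w, would have volume at most
   L. *)
have ms : m < s.
  rewrite ltNge; apply/negP => sm; have : (lebesgue_rV n (order_interval v) <= L%:E)%E.
    rewrite vE scalemxAl order_interval_act// -LE; apply: le_measure; rewrite ?inE.
    - exact: order_interval_measurable.
    - exact: order_interval_measurable.
    move=> x [Cx Csw]; split => //.
    rewrite (_ : _ - x = s *: w - x + (m *: (m *: e - w) + (m - s) *: w)); last by rV_ring.
    apply: coneD => //; apply: (cone_closureD C_open C_cone); first exact: coneZ.
    have [->|sm1] := eqVneq s m; first by rewrite subrr scale0r; exact: closure_cone0.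
    by apply: subset_closure; apply: coneZ; rewrite // subr_gt0 lt_neqAle sm1.
  by move=> /(le_trans vol); rewrite lee_fin leNgt LN.
exists A => //; rewrite -/v vE scalemxAl -mulmxBl; apply: (gam_cone Gam_div) => //.
rewrite (_ : s *: w - e = m *: w - e + (s - m) *: w); last by rV_ring.
by apply: coneD => //; apply: coneZ; rewrite ?subr_gt0.
Qed.

(** * Points where e is the longest direction, and a fundamental set *)

Definition longest_direction e :=
  [set x | D x /\ forall g, Gamt g ->
    past_length D x (e *m g.1) <= past_length D x e].

(* Let p be in K, x not in K and s = past_length x e. Then w = x - s e - p is at
   distance at least r s of C, but its distance to C is small compared to |w|
   if w is large. Hence s is small compared to |w|, and by convexity D contains
   some x - (s e + l w) for which l w / s is large and close to C. By
   orbit_coarse, s e + l w - s e g is in C for some g, so that the past length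
   of x is larger in the direction e g. *)
Lemma longest_direction_bounded e (K : set V) : C e -> C_convex_domain C K ->
  K `<=` D -> exists M : R, forall x, longest_direction e x -> ~ K x -> `|x| <= M.
Proof.
move=> Ce K_dom KD; have [p Kp] : K !=set0 by case: K_dom => -[].
have Dp := KD _ Kp.
have [r r0 rC] := cone_ball C_open Ce.
have [MV MVP] := orbit_coarse Ce.
pose MV' := `|MV| + 1.
have MV0 : 0 < MV' by rewrite ltr_wpDl.
(* The bound 1/2 yields |c| >= |w| / 2 for the c approximating w; the other one makes (l / s) c at
   least [MV] long, as its length is at least r / (6 q) for the l chosen below. *)
pose q := Num.min (2^-1) (r / (6 * MV')).
have q0 : 0 < q by rewrite lt_min invr_gt0 ltr0n divr_gt0// mulr_gt0.
have q1 : q <= 2^-1 by rewrite ge_min lexx.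
have q2 : q * (6 * MV') <= r.
  by rewrite -ler_pdivlMr ?mulr_gt0// ge_min lexx orbT.
have [Mw MwP] := dom_asymptotic C_cone D_dom Dp q0.
exists (`|p| + `|Mw| + `|Mw| / r * `|e|) => x [Dx xmax] nKx.
have s0 := len_gt0 Dx Ce; have cz := past_length_closure C_cone C_proper D_dom (C_neq0 Ce) Dx Ce.
move: (past_length D x e) s0 cz xmax => s s0 cz xmax.
pose w := x - s *: e - p.
have xE : x = p + (w + s *: e) by rewrite /w; rV_ring.
have nC : ~ C (w + s *: e).
  by move=> Cw; apply: nKx; rewrite xE; apply: (domD_cone K_dom).
have near c : closure C c -> s * r <= `|w - c|.
  move=> Cc; rewrite leNgt; apply/negP => wc; apply: nC.
  rewrite (_ : w + s *: e = s *: (e + s^-1 *: (w - c)) + c).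
    apply: (cone_closureD C_open C_cone) => //; apply: coneZ => //; apply: rC.
    by rewrite normrZ gtr0_norm ?invr_gt0// ltr_pdivrMl.
  by have := lt0r_neq0 s0 => s0'; rV_field.
have [wM|wM] := leP `|w| `|Mw|.
  have sM : s <= `|Mw| / r.
    rewrite ler_pdivlMr//; apply: le_trans wM.
    by have := near 0 (closure_cone0 C_cone C_proper); rewrite subr0.
  rewrite xE; apply: le_trans (ler_normD _ _) _; rewrite -[leRHS]addrA lerD2l.
  apply: le_trans (ler_normD _ _) _; rewrite lerD// normrZ gtr0_norm//.
  by rewrite ler_wpM2r.
exfalso.
have w0 : 0 < `|w| by exact: le_lt_trans wM.
have [||c Cc wc] := MwP w.
- by rewrite /w addrC subrK.
- exact: le_lt_trans (ler_norm _) wM.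
have srw := le_trans (near c Cc) wc.
(* Chosen so that (l / s) |w - c| <= r / 3: an error that e / 2 absorbs, since 2 r / 3 < r. As s r
   <= |w - c| <= q |w|, it is also less than 1. *)
pose l := s * r / (3 * (q * `|w|)).
have qw0 : 0 < q * `|w| by rewrite mulr_gt0.
have l0 : 0 < l by rewrite divr_gt0// mulr_gt0.
have [q_neq0 w_neq0 s_neq0] := And3 (lt0r_neq0 q0) (lt0r_neq0 w0) (lt0r_neq0 s0).
have lE : l * (q * `|w|) = s * r / 3.
  by rewrite /l; move: (`|w|) w_neq0 => W W0; field; rewrite ?W0 ?q_neq0.
have l1 : l < 1.
  by rewrite ltr_pdivrMr ?mulr_gt0// mul1r; lra.
clearbody l; pose v := s *: e + l *: w.
have Dxv : D (x - v).
  rewrite (_ : x - v = l *: p + (1 - l) *: (x - s *: e)).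
    by apply: (cvx_interior (dom_open D_dom) (dom_cvx D_dom)) => //; exact: ltW.
  by rewrite /v /w; rV_ring.
have lc : MV <= `|(l / s) *: c|.
  have cw : `|w| / 2 <= `|c|.
    have : `|w| <= `|w - c| + `|c|.
      by rewrite -{1}(subrK c w) ler_normD.
    have : q * `|w| <= 2^-1 * `|w| by rewrite ler_pM2r.
    by move: wc; lra.
  rewrite normrZ gtr0_norm ?divr_gt0//.
  apply: (@le_trans _ _ (l / s * (`|w| / 2))); last by rewrite (ler_pM2l (divr_gt0 l0 s0)).
  rewrite -(ler_pM2r q0) -(ler_pM2r s0).
  have -> : l / s * (`|w| / 2) * q * s = s * r / 6.
    have -> : s * r / 6 = (s * r / 3) / 2 by field.
    by rewrite -lE; move: (`|w|) => W; field.
  have : s * (q * (6 * MV')) <= s * r by rewrite ler_pM2l.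
  have : MV * q * s <= MV' * q * s.
    by rewrite !ler_pM2r// /MV'; have := ler_norm MV; lra.
  by lra.
have Clc : closure C ((l / s) *: c) by apply: closure_coneZ; rewrite // divr_gt0.
have [A GA CA] := MVP _ Clc lc.
have [g Gg gA] : exists2 g, Gamt g & g.1 = A.
  by case: Gamt_def => _ [_ _ surj]; have [g Gg gA] := surj _ GA; exists g.
have Cv : C (v - s *: (e *m A)).
  rewrite (_ : _ - _ = s *: ((2^-1 *: e + (l / s) *: c - e *m A) +
      2^-1 *: (e + (2 * (l / s)) *: (w - c)))).
    apply: coneZ => //; apply: coneD => //; apply: coneZ => //; apply: rC.
    rewrite normrZ gtr0_norm; last by rewrite mulr_gt0// divr_gt0.
    apply: (@le_lt_trans _ _ (2 * (l / s) * (q * `|w|))).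
      by rewrite ler_pM2l ?wc//; apply: mulr_gt0 => //; apply: divr_gt0.
    have -> : 2 * (l / s) * (q * `|w|) = 2 / s * (l * (q * `|w|)) by ring.
    rewrite lE (_ : _ * _ = 2 / 3 * r); last by field.
    by lra.
  by have := lt0r_neq0 s0 => s0'; rewrite /v; rV_field.
have CeA : C (e *m g.1) by exact: gamt_cone.
have : s < past_length D x (e *m g.1).
  apply/lenP => //; first exact: ltW.
  rewrite gA (_ : x - _ = x - v + (v - s *: (e *m A))); last by rV_ring.
  by apply: (domD_cone D_dom).
by apply/negP; rewrite -leNgt; exact: xmax.
Qed.

Lemma unfold_weight_mono e x u : C e -> 0 <= u -> psi e x <= psi e (x + u *: e).
Proof.
move=> Ce u0; have [->|un0] := eqVneq u 0; first by rewrite scale0r addr0.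
have [Dx|nDx] := pselect (D x); last first.
  by rewrite {1}/unfold_weight asboolF// unfold_weight_ge0.
have Dxu : D (x + u *: e).
  by apply: (domD_cone D_dom) => //; apply: coneZ; rewrite // lt0r un0.
have l0 := len_gt0 Dx Ce; set l := past_length D x e in l0.
have W0 := weight_sum_gt0 Ce Dx; have Wu0 := weight_sum_gt0 Ce Dxu.
have Wfin := weight_sum_fin Ce Dx; have Wufin := weight_sum_fin Ce Dxu.
rewrite /unfold_weight !asboolT//.
rewrite (past_length_shift C_cone C_proper D_dom)//; last exact: C_neq0.
rewrite -/l ler_pdivrMr ?fine_gt0 ?W0// mulrAC ler_pdivlMr ?fine_gt0 ?Wu0//.
have pl0 y g : Gamt g -> (0 <= ((past_length D y (e *m g.1)) ^+ n)%:E)%E.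
  by move=> _; rewrite lee_fin exprn_ge0// past_length_ge0.
have : ((l ^+ n)%:E * weight_sum e (x + u *: e) <=
    ((l + u) ^+ n)%:E * weight_sum e x)%E.
  rewrite /weight_sum.
  rewrite -(countable_esumZl gamt_countable (fun g y => pl0 y g)); last first.
    by rewrite exprn_ge0// ltW.
  rewrite -(countable_esumZl gamt_countable (fun g y => pl0 y g)); last first.
    by rewrite exprn_ge0// addr_ge0// ltW.
  apply: le_esum => g Gg /=; rewrite -!EFinM lee_fin -!exprMn.
  have Cg : C (e *m g.1) by exact: gamt_cone.
  rewrite lerXn2r ?nnegrE ?mulr_ge0 ?addr_ge0 ?past_length_ge0 ?(ltW l0)//.
  rewrite mulrC [leRHS]mulrC.
  by apply: (past_length_homothety C_cone C_proper D_dom) => //; exact: C_neq0.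
have fW y : (0 < weight_sum e y)%E -> (weight_sum e y < +oo)%E ->
    weight_sum e y = (fine (weight_sum e y))%:E.
  by move=> y0 yoo; rewrite fineK// ge0_fin_numE// ltW.
by rewrite (fW x)// (fW (x + _))// -!EFinM lee_fin.
Qed.

Lemma measurable_longest e : C e -> measurable (longest_direction e).
Proof.
move=> Ce; rewrite (_ : longest_direction e = D `&` \bigcap_(g in Gamt)
    [set x | past_length_on (e *m g.1) x <= past_length_on e x]).
  apply: measurableI; first by apply: open_measurable_rV; exact: dom_open D_dom.
  apply: countable_bigcap_measurable => // g Gg; rewrite -[X in measurable X]setTI.
  apply: measurable_fun_le => //; first by apply: measurable_past_length; exact: gamt_cone.
  exact: measurable_past_length.
apply/seteqP; split=> x [Dx lx]; split => // g Gg; have := lx g Gg;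
  by rewrite /= /past_length_on asboolT.
Qed.

Lemma longest_act e g x : C e -> Gamt g -> longest_direction e (aff_act g x) <->
  D x /\ forall h, Gamt h -> past_length D x (e *m h.1) <=
    past_length D x (e *m (aff_inv g).1).
Proof.
move=> Ce Gg.
have E h : Gamt h -> past_length D (aff_act g x) (e *m h.1) =
    past_length D x (e *m (aff_comp h (aff_inv g)).1).
  move=> Gh; rewrite -(past_length_act x _ Gg) /= -!mulmxA mulVmx ?gamt_unit//.
  by rewrite mulmx1.
have E1 : past_length D (aff_act g x) e = past_length D x (e *m (aff_inv g).1).
  by rewrite -[e in LHS]mulmx1 (E _ gamt_id) /= mul1mx.
split=> -[Dx lx]; split; try exact/(domain_act x Gg).
  move=> h Gh; rewrite -E1; have := lx _ (gamt_comp Gh Gg).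
  by rewrite E; [rewrite aff_compA gamt_compV// aff_comp_id|exact: gamt_comp].
by move=> h Gh; rewrite E// E1; apply: lx; apply: gamt_comp => //; exact: gamt_inv.
Qed.

Lemma longest_orbit_finite e x : C e -> D x ->
  finite_set [set g | Gamt g /\ longest_direction e (aff_act g x)].
Proof.
move=> Ce Dx; apply: (@sub_finite_set _ _
  (@aff_inv R n @` [set g | Gamt g /\ past_length D x e <= past_length D x (e *m g.1)])).
  move=> g [Gg /(longest_act _ Ce Gg)[_ lx]]; exists (aff_inv g).
    split; first exact: gamt_inv.
    by have := lx _ gamt_id; rewrite /= mulmx1.
  exact: aff_invK.
by apply: finite_image; apply: past_length_finite => //; exact: len_gt0.
Qed.

(** Only finitely many directions e g are at least as long as e at x, so the maximum is attained;
    the inverse of a maximizing element moves x to the required point. *)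
Lemma longest_orbit_exists e x : C e -> D x ->
  exists2 g, Gamt g & longest_direction e (aff_act g x).
Proof.
move=> Ce Dx; have l0 := len_gt0 Dx Ce.
have [|k [Gk kl] kP] := finite_set_argmin (fun g => - past_length D x (e *m g.1))
  (past_length_finite Ce Dx l0).
  by exists (@aff_id R n); split; [exact: gamt_id|rewrite /= mulmx1].
exists (aff_inv k); first exact: gamt_inv.
apply/longest_act => //; first exact: gamt_inv.
split=> // h Gh; rewrite aff_invK//.
have [lh|hl] := leP (past_length D x e) (past_length D x (e *m h.1)).
  by rewrite -lerN2; apply: kP.
by apply: le_trans kl; exact: ltW.
Qed.

(* The lexicographic order selects one of the finitely many points of an orbit
   whose longest direction is e. *)
Definition fundamental_set e := [set x | longest_direction e x /\
  forall g, Gamt g -> longest_direction e (aff_act g x) ->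
    (lexi_rV x <= lexi_rV (aff_act g x))%O].

Lemma measurable_fundamental e : C e -> measurable (fundamental_set e).
Proof.
move=> Ce; have mlong := measurable_longest Ce.
have mact g : Gamt g -> measurable_fun setT (aff_act g).
  by move=> Gg; have [] := gamt_act_preserving Gg.
rewrite (_ : fundamental_set e = longest_direction e `&` \bigcap_(g in Gamt)
  (~` (aff_act g @^-1` longest_direction e) `|`
   [set x | (lexi_rV x <= lexi_rV (aff_act g x))%O])).
  apply: measurableI => //; apply: countable_bigcap_measurable => // g Gg.
  apply: measurableU; last by apply: measurable_lexi_le => //; exact: mact.
  by apply: measurableC; rewrite -[X in measurable X]setTI; exact: mact.
apply/seteqP; split=> x [lx xP]; split => // g Gg.
  have [lg|] := pselect (longest_direction e (aff_act g x)); last by left.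
  by right; exact: xP.
by move=> lg; case: (xP g Gg).
Qed.

Lemma fundamental_inj e : set_inj (fundamental_set e) (orbit_of aff_act Gamt).
Proof.
move=> x y /set_mem[lx xP] /set_mem[ly yP] xy; apply: lexi_rV_inj.
have orb z : orbit_of aff_act Gamt z z.
  by exists (@aff_id R n); [exact: gamt_id|rewrite aff_act_id].
have [g Gg gx] : orbit_of aff_act Gamt x y by rewrite xy.
have [h Gh hy] : orbit_of aff_act Gamt y x by rewrite -xy.
apply/le_anti/andP; split.
  by have := xP g Gg; rewrite gx; exact.
by have := yP h Gh; rewrite hy; exact.
Qed.

Lemma fundamental_cover e x : C e -> D x ->
  exists2 g, Gamt g & (aff_act g @` fundamental_set e) x.
Proof.
move=> Ce Dx.
have [|g [Gg lg] gP] := finite_set_argmin (fun g => lexi_rV (aff_act g x))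
  (longest_orbit_finite Ce Dx).
  by have [g Gg lg] := longest_orbit_exists Ce Dx; exists g.
exists (aff_inv g); first exact: gamt_inv.
exists (aff_act g x); last exact: gamt_actK.
split=> // h Gh; rewrite -aff_act_comp => lgh.
by apply: gP; split => //; exact: gamt_comp.
Qed.

(** An orbit that avoids K lies in D \ K, whether or not K is invariant: the bound therefore applies
    directly to the convex combination. *)
Lemma covol_le_integral e (K : set V) : C e -> measurable K ->
  (covol Gamt D K <= \int[lebesgue_rV n]_(x in D `\` K) (psi e x)%:E)%E.
Proof.
move=> Ce mK; apply: ge_ereal_sup => _ [U [mU Uinj UDK] <-].
have mD : measurable D by apply: open_measurable_rV; exact: dom_open D_dom.
have orb g u : Gamt g -> orbit_of aff_act Gamt (aff_act g u) = orbit_of aff_act Gamt u.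
  move=> Gg; apply/seteqP; split=> _ [k Gk <-].
    by exists (aff_comp g k); [exact: gamt_comp|rewrite aff_act_comp].
  exists (aff_comp (aff_inv g) k); first by apply: gamt_comp => //; exact: gamt_inv.
  by rewrite aff_act_comp gamt_actK.
have UD : U `<=` D.
  move=> u Uu; have [[x Dx xu] _] : (quot Gamt D `\` quot Gamt K) (orbit_of aff_act Gamt u).
    by apply: UDK; exists u.
  have [g Gg <-] : orbit_of aff_act Gamt x u.
    by rewrite xu; exists (@aff_id R n); [exact: gamt_id|rewrite aff_act_id].
  exact/domain_act.
apply: measure_le_unfold => //; first exact: measurableD.
move=> u g Uu Gg; split; first by apply/domain_act => //; exact: UD.
move=> Kgu; have [_] : (quot Gamt D `\` quot Gamt K) (orbit_of aff_act Gamt u).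
  by apply: UDK; exists u.
by apply; exists (aff_act g u) => //; exact: orb.
Qed.

Section invariant_domain.
Variables (e : V) (K : set V).
Hypotheses (Ce : C e) (K_tau : tau_convex_domain C Gamt K).

Let mK : measurable K.
Proof. by case: K_tau => K_dom _; apply: open_measurable_rV; exact: dom_open K_dom. Qed.

Let mD : measurable D. Proof. by apply: open_measurable_rV; exact: dom_open D_dom. Qed.

Let mU : measurable (fundamental_set e `\` K).
Proof. by apply: measurableD => //; exact: measurable_fundamental. Qed.

(** The translates of the fundamental set minus K cover D \ K by invariance of K. The same set also
    competes in the supremum defining the covolume. *)
Let integral_le : (\int[lebesgue_rV n]_(x in D `\` K) (psi e x)%:E <=
  lebesgue_rV n (fundamental_set e `\` K))%E.
Proof.
apply: unfold_le_measure => //; first by move=> x [[[]]].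
  exact: measurableD.
move=> x [Dx nKx]; have [g Gg [u Uu ux]] := fundamental_cover Ce Dx.
exists g => //; exists u => //; split=> // Ku; apply: nKx; rewrite -ux.
by apply/invariant_act => //; case: K_tau.
Qed.

Lemma integral_le_covol :
  (\int[lebesgue_rV n]_(x in D `\` K) (psi e x)%:E <= covol Gamt D K)%E.
Proof.
apply: le_trans integral_le _; apply: ereal_sup_ubound.
exists (fundamental_set e `\` K) => //; split => //.
  by move=> x y /set_mem[Ux _] /set_mem[Uy _]; exact: (fundamental_inj (mem_set Ux) (mem_set Uy)).
move=> _ [u [Uu nKu] <-]; split; first by exists u => //; case: Uu => -[].
move=> [x Kx xu]; apply: nKu.
have [g Gg <-] : orbit_of aff_act Gamt x u.
  by rewrite xu; exists (@aff_id R n); [exact: gamt_id|rewrite aff_act_id].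
by apply/invariant_act => //; case: K_tau.
Qed.

Lemma integral_unfold_fin : K `<=` D ->
  (\int[lebesgue_rV n]_(x in D `\` K) (psi e x)%:E < +oo)%E.
Proof.
move=> KD; apply: le_lt_trans integral_le _.
have [M MP] := longest_direction_bounded Ce K_tau.1 KD.
by apply: (@bounded_rV_fin _ _ _ M) => [|x [[lx _] nKx]]; [exact: mU|exact: MP].
Qed.

End invariant_domain.

End affine_deformation.

(** * Strict convexity of the covolume *)

Section strict_inequality.
Context {R : realType} {k : nat}.
Local Notation V := 'rV[R]_k.+2.
Variables (C D : set V) (Gam : set 'M[R]_k.+2) (Gamt : set (@affine_map R k.+2)).
Hypotheses (C_open : open C) (C_cone : convex_cone C) (C_proper : proper_cone C).
Hypotheses (Gam_SL : is_subgroup_SL Gam) (Gam_div : divides Gam C).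
Hypothesis Gamt_def : affine_deformation Gam Gamt.
Hypothesis D_tau : tau_convex_domain C Gamt D.
Variables (K0 K1 : set V) (t : R) (e : V).
Hypotheses (K0_tau : tau_convex_domain C Gamt K0) (K1_tau : tau_convex_domain C Gamt K1).
Hypotheses (K0D : K0 `<=` D) (K1D : K1 `<=` D) (t0 : 0 < t) (t1 : t < 1).
Hypotheses (Ce : C e) (e00 : e ord0 ord0 != 0).

Let n_gt0 : (0 < k.+2)%N. Proof. by []. Qed.
Let D_dom : C_convex_domain C D. Proof. by case: D_tau. Qed.
Let K0_dom : C_convex_domain C K0. Proof. by case: K0_tau. Qed.
Let K1_dom : C_convex_domain C K1. Proof. by case: K1_tau. Qed.
Let e_neq0 : e != 0. Proof. exact: (cone_mem_neq0 n_gt0 C_open C_cone C_proper). Qed.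
Local Notation psi := (unfold_weight D Gamt e).
Local Notation mu := (lebesgue_rV k.+2).
Local Notation L := (line_comb e t K0 K1).
Local Notation Kt := (convex_comb t K0 K1).

Let mpsi : measurable_fun setT psi.
Proof. exact: (measurable_unfold_weight n_gt0 C_open C_cone C_proper Gam_SL Gam_div Gamt_def D_tau). Qed.

Let psi_ge0 x : 0 <= psi x. Proof. exact: unfold_weight_ge0. Qed.

Let mEpsi (A : set V) : measurable_fun A (fun x => (psi x)%:E).
Proof. by apply/measurable_EFinP; exact: measurable_funTS. Qed.

Let psi_out (K : set V) :
  (\int[mu]_(x in ~` K) (psi x)%:E = \int[mu]_(x in D `\` K) (psi x)%:E)%E.
Proof.
rewrite [LHS]integral_mkcond [RHS]integral_mkcond; apply: eq_integral => x _.
rewrite !patchE; have [Dx|nDx] := pselect (D x).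
  congr (if _ then _ else _); apply/idP/idP; rewrite !inE; first by split.
  by case.
by rewrite /unfold_weight asboolF// !if_same.
Qed.

Let Kt_sub : Kt `<=` D.
Proof.
move=> _ [P /K0D DP [P' /K1D DP' <-]].
rewrite (_ : _ + _ = t *: P' + (1 - t) *: P); last by rV_ring.
by apply: (dom_cvx D_dom DP' DP); exact: ltW.
Qed.

Let line_le : (\int[mu]_(x in D `\` L) (psi x)%:E <=
  (1 - t)%:E * covol Gamt D K0 + t%:E * covol Gamt D K1)%E.
Proof.
have oK0 := dom_open K0_dom; have oK1 := dom_open K1_dom.
have [a aP] := domain_line C_open C_cone C_proper e_neq0 Ce K0_dom.
have [b bP] := domain_line C_open C_cone C_proper e_neq0 Ce K1_dom.
have lines x : exists a b : R, [/\ forall s, K0 (x + s *: e) <-> a < s,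
    forall s, K1 (x + s *: e) <-> b < s
  & forall s, L (x + s *: e) <-> (1 - t) * a + t * b < s].
  by exists (a x), (b x); split=> //; exact: line_combP.
have mono x u : 0 <= u -> psi x <= psi (x + u *: e).
  exact: (unfold_weight_mono n_gt0 C_open C_cone C_proper Gam_SL Gam_div Gamt_def D_tau).
have := integral_line_comb e00 t0 t1 mpsi psi_ge0 mono (open_measurable_rV oK0)
  (open_measurable_rV oK1) (open_measurable_rV (line_comb_open (e:=e) (t:=t) oK0 oK1)) lines.
move=> lc; rewrite -psi_out; apply: (le_trans lc).
rewrite !psi_out; apply: leeD.
  rewrite lee_wpmul2l ?lee_fin ?subr_ge0 ?(ltW t1)//.
  exact: (integral_le_covol n_gt0 C_open C_cone C_proper Gam_SL Gam_div Gamt_def D_tau).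
rewrite lee_wpmul2l ?lee_fin ?(ltW t0)//.
exact: (integral_le_covol n_gt0 C_open C_cone C_proper Gam_SL Gam_div Gamt_def D_tau).
Qed.

Let rhs_fin : ((1 - t)%:E * covol Gamt D K0 + t%:E * covol Gamt D K1 < +oo)%E.
Proof.
have cov K : tau_convex_domain C Gamt K -> K `<=` D -> (covol Gamt D K < +oo)%E.
  move=> K_tau KD.
  apply: le_lt_trans (integral_unfold_fin n_gt0 C_open C_cone C_proper Gam_SL
    Gam_div Gamt_def D_tau Ce K_tau KD).
  apply: (covol_le_integral n_gt0 C_open C_cone C_proper Gam_SL Gam_div Gamt_def D_tau) => //.
  by apply: open_measurable_rV; case: K_tau => K_dom _; exact: dom_open K_dom.
by rewrite lte_add_pinfty// lte_mul_pinfty// ?lee_fin ?subr_ge0 ?(ltW t1) ?(ltW t0)// cov.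
Qed.

Lemma covol_convex_comb_lt : ~ (Kt `<=` L) ->
  (covol Gamt D Kt < (1 - t)%:E * covol Gamt D K0 + t%:E * covol Gamt D K1)%E.
Proof.
move=> /(line_comb_gap C_open C_cone t1 K0_dom K1_dom Ce)[z [r [r0 zP]]].
pose B := [set y : V | `|z - y| < r].
have oB : open B.
  apply/openP_norm => y By; exists (r - `|z - y|) => [|w yw]; first by rewrite subr_gt0.
  rewrite /B /= -(subrK y z) -addrA; apply: le_lt_trans (ler_normD _ _) _.
  by rewrite -ltrBrDl.
have mB := open_measurable_rV oB.
have oK0 := dom_open K0_dom; have oK1 := dom_open K1_dom.
have mKt : measurable Kt.
  by apply: open_measurable_rV; exact: convex_comb_open.
have mL : measurable L by apply: open_measurable_rV; exact: line_comb_open.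
have mD : measurable D by apply: open_measurable_rV; exact: dom_open D_dom.
(* A zero integral would make the weight vanish almost everywhere on B, although it is positive
   there and B has positive volume. *)
have B_gt0 : (0 < \int[mu]_(x in B) (psi x)%:E)%E.
  rewrite lt0e integral_ge0 ?andbT//; last by move=> x _; rewrite lee_fin.
  apply/eqP => I0; have : ae_eq mu B (fun x => (psi x)%:E) (cst 0%E).
    apply/ae_eq_integral_abs => //; rewrite -[RHS]I0.
    by apply: eq_integral => x _; rewrite gee0_abs ?lee_fin.
  move=> [N [mN N0 BN]]; have : (0 < mu B)%E.
    by apply: open_rV_gt0 => //; exists z; rewrite /B /= subrr normr0.
  apply/negP; rewrite -leNgt -N0; apply: le_measure; rewrite ?inE//.
  move=> x Bx; apply: BN => /= /(_ Bx)[psi0].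
  have := unfold_weight_gt0 n_gt0 C_open C_cone C_proper Gam_SL Gam_div Gamt_def D_tau
    Ce (Kt_sub (zP _ Bx).1).
  by rewrite psi0 ltxx.
have gap : (\int[mu]_(x in D `\` Kt) (psi x)%:E + \int[mu]_(x in B) (psi x)%:E <=
    \int[mu]_(x in D `\` L) (psi x)%:E)%E.
  rewrite -ge0_integral_setU//.
  - apply: ge0_subset_integral => //.
    + by apply: measurableU => //; exact: measurableD.
    + exact: measurableD.
    + by move=> x _; rewrite lee_fin.
    move=> x [[Dx nKx]|Bx]; first by split=> // /line_comb_sub.
    by split; [exact/Kt_sub/(zP _ Bx).1|exact: (zP _ Bx).2].
  - exact: measurableD.
  - by move=> x _; rewrite lee_fin.
  - by apply/disj_setPS => x [[_ nKx] Bx]; apply: nKx; exact: (zP _ Bx).1.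
have Ifin : (\int[mu]_(x in D `\` Kt) (psi x)%:E < +oo)%E.
  apply: le_lt_trans rhs_fin; apply: le_trans line_le; apply: le_trans gap.
  by rewrite leeDl// ltW.
apply: le_lt_trans (covol_le_integral n_gt0 C_open C_cone C_proper Gam_SL Gam_div
  Gamt_def D_tau Ce mKt) _.
apply: lt_le_trans line_le; apply: lt_le_trans gap.
rewrite lteDl// ge0_fin_numE//; apply: integral_ge0 => x _; by rewrite lee_fin.
Qed.

End strict_inequality.

(** Supplies directions of C with a nonzero first coordinate, and then a second direction
    independent of the first. *)
Lemma perturb_coord {R : realType} {n : nat} (C : set 'rV[R]_n) x i : open C ->
  C x -> exists2 s : R, 0 < s & C (x + s *: delta_mx ord0 i).
Proof.
move=> C_open Cx; have [r r0 rC] := cone_ball C_open Cx.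
exists (r / 2); first by rewrite divr_gt0.
apply: rC; apply/rV_norm_ltP => // j; rewrite !mxE eqxx /=.
by case: eqP => _; rewrite ?mulr1 ?mulr0 ?normr0// ger0_norm; lra.
Qed.

Theorem theorem6p3 (R : realType) (d : nat) (hd : (2 <= d)%N)
    (C : set 'rV[R]_d.+1)
    (C_open : open C) (C_cone : convex_cone C) (C_proper : proper_cone C)
    (Gam : set 'M[R]_d.+1)
    (Gam_SL : is_subgroup_SL Gam) (Gam_div : divides Gam C)
    (Gamt : set (@affine_map R d.+1))
    (Gamt_def : affine_deformation Gam Gamt)
    (D : set 'rV[R]_d.+1) (D_max : max_tau_convex_domain C Gamt D)
    (K0 K1 : set 'rV[R]_d.+1)
    (K0_tau : tau_convex_domain C Gamt K0)
    (K1_tau : tau_convex_domain C Gamt K1)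
    (K0_neq_K1 : K0 <> K1)
    (t : R) (t_gt0 : 0 < t) (t_lt1 : t < 1) :
  (covol Gamt D (convex_comb t K0 K1) <
   (1 - t)%:E * covol Gamt D K0 + t%:E * covol Gamt D K1)%E.
Proof.
case: d hd C C_open C_cone C_proper Gam Gam_SL Gam_div Gamt Gamt_def D D_max
  K0 K1 K0_tau K1_tau K0_neq_K1 => [//|k] _ C C_open C_cone C_proper Gam Gam_SL
  Gam_div Gamt Gamt_def D [D_tau D_max] K0 K1 K0_tau K1_tau K0_neq_K1.
have lt e : C e -> e ord0 ord0 != 0 ->
    ~ (convex_comb t K0 K1 `<=` line_comb e t K0 K1) ->
    (covol Gamt D (convex_comb t K0 K1) <
     (1 - t)%:E * covol Gamt D K0 + t%:E * covol Gamt D K1)%E.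
  by move=> Ce e00; apply: (covol_convex_comb_lt C_open C_cone C_proper Gam_SL
    Gam_div Gamt_def D_tau K0_tau K1_tau _ _ t_gt0 t_lt1 Ce e00); exact: D_max.
have [p Cp] : C !=set0 by case: C_proper.
have [e1 Ce1 e10] : exists2 e1, C e1 & e1 ord0 ord0 != 0.
  have [p0|] := eqVneq (p ord0 ord0) 0; last by exists p.
  have [s s0 Cs] := perturb_coord ord0 C_open Cp; exists (p + s *: delta_mx 0 0) => //.
  by rewrite !mxE p0 add0r mulr1 lt0r_neq0.
(* The second direction keeps the first coordinate of e1, which is nonzero and will give c1 = c2;
   comparing the next coordinate then gives c1 s = 0. *)
have [s s0 Ce2] := perturb_coord (lift ord0 ord0) C_open Ce1.
set e2 := e1 + _ in Ce2.
have e20 : e2 ord0 ord0 = e1 ord0 ord0 by rewrite !mxE mulr0 addr0.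
have [K1e|/lt] := pselect (convex_comb t K0 K1 `<=` line_comb e1 t K0 K1); last exact.
have [K2e|/lt] := pselect (convex_comb t K0 K1 `<=` line_comb e2 t K0 K1); last first.
  by apply=> //; rewrite e20.
have rigid e : C e -> convex_comb t K0 K1 `<=` line_comb e t K0 K1 ->
    exists c : R, forall x, K0 x <-> K1 (x - c *: e).
  move=> Ce; apply: (line_comb_rigid C_open C_cone C_proper t_gt0 t_lt1 K0_tau.1 K1_tau.1) => //.
  exact: (cone_mem_neq0 _ C_open C_cone C_proper).
have [c1 E1] := rigid _ Ce1 K1e; have [c2 E2] := rigid _ Ce2 K2e.
have c12 := translates_eq C_cone C_proper K1_tau.1 E1 E2.
have cc : c1 = c2.
  have := congr1 (fun x : 'rV_k.+2 => x ord0 ord0) c12.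
  by rewrite mxE [RHS]mxE e20 => /(mulIf e10).
have c0 : c1 = 0.
  have := congr1 (fun x : 'rV_k.+2 => x ord0 (lift ord0 ord0)) c12.
  rewrite -cc !mxE eqxx /= mulr1 mulrDr => /esym/eqP.
  by rewrite -subr_eq0 addrC addKr mulf_eq0 (gt_eqF s0) orbF => /eqP.
exfalso; apply: K0_neq_K1; apply/seteqP.
by split=> x; rewrite E1 c0 scale0r subr0.
Qed.
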